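(* The problems Con-Vol$(p)$ and Con-Vol$(p,k)$ can be solved in $O(n)$ and $O(nk^2p)$ time, respectively.
   Context: Let $N=\{1,\ldots,n\}$ be a set of items. An instance consists of non-negative rational vectors $C=(C_1,\ldots,C_n)$ (fixed costs), $\underline c=(\underline c_1,\ldots,\underline c_n)$ (nominal uncertain costs), $d=(d_1,\ldots,d_n)$ (maximal deviations), a positive rational number $\Gamma$ (uncertainty budget), and positive integers $p$ and (where applicable) $k$ with $k\le p\le n$. Decisions are binary vectors $x,y\in\{0,1\}^n$; products such as $Cx$ denote scalar products. Define $$F(p)=\Big\{(x,y): \sum_{i\in N}(x_i+y_i)=p,\ \sum_{i\in N}x_iy_i=0\Big\},$$ $$F(p,k)=\Big\{(x,y): \sum_{i\in N}x_i=p,\ \sum_{i\in N}y_i=p,\ \sum_{i\in N}x_iy_i\ge p-k\Big\}.$$ Con-Vol$(p)$ and Con-Vol$(p,k)$ (continuous uncertainty with volume budget) are the problem $$\min_{(x,y)\in F}\Big\{Cx+\max_{0\le\delta\le d}\big\{(\underline c+\delta)y: \sum_{i\in N}\delta_i\le\Gamma\big\}\Big\}$$ with $F=F(p)$ and $F=F(p,k)$, respectively, where $\delta=(\delta_1,\ldots,\delta_n)$ is a real vector. Solving a problem means computing the optimal value and an optimal $(x,y)$. Running time counts elementary arithmetic operations and comparisons on numbers. *)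

(* Defs.v *)
From mathcomp Require Import all_boot all_order all_algebra.
From mathcomp Require Import classical_sets reals.

Set Implicit Arguments.
Unset Strict Implicit.
Unset Printing Implicit Defensive.

Import Order.TTheory GRing.Theory Num.Theory.

Local Open Scope ring_scope.

(** * The optimization problems *)

Record instance (n : nat) := Instance {
  fixed_cost : {ffun 'I_n -> rat};
  nominal_cost : {ffun 'I_n -> rat};
  deviation : {ffun 'I_n -> rat};
  budget : rat
}.

Definition valid n (I : instance n) : Prop :=
  [/\ forall i, 0 <= fixed_cost I i,
      forall i, 0 <= nominal_cost I i,
      forall i, 0 <= deviation I i
    & 0 < budget I].

Notation binvec n := {ffun 'I_n -> bool}.

Definition feasible_p n (p : nat) (x y : binvec n) : Prop :=
  (\sum_(i < n) (x i + y i))%N = p /\ (\sum_(i < n) x i * y i)%N = 0%N.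

(* [p - k] is truncated; the problem is only considered for [k <= p]. *)
Definition feasible_pk n (p k : nat) (x y : binvec n) : Prop :=
  [/\ (\sum_(i < n) x i)%N = p,
      (\sum_(i < n) y i)%N = p
    & (p - k <= \sum_(i < n) x i * y i)%N].

Section Objective.
Variables (R : realType) (n : nat) (I : instance n).

Definition scenarios : set {ffun 'I_n -> R} :=
  [set delta : {ffun 'I_n -> R} |
    (forall i, 0 <= delta i <= ratr (deviation I i)) /\
    \sum_(i < n) delta i <= ratr (budget I)].

Definition first_stage_cost (x : binvec n) : R :=
  \sum_(i < n) ratr (fixed_cost I i) * (x i)%:R.

Definition second_stage_cost (y : binvec n) (delta : {ffun 'I_n -> R}) : R :=
  \sum_(i < n) (ratr (nominal_cost I i) + delta i) * (y i)%:R.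

Definition worst_case (y : binvec n) (w : R) : Prop :=
  (exists2 delta, scenarios delta & second_stage_cost y delta = w) /\
  (forall delta, scenarios delta -> second_stage_cost y delta <= w).

Definition robust_cost (x y : binvec n) (v : R) : Prop :=
  exists2 w, worst_case y w & v = first_stage_cost x + w.

(* The last clause also asserts that the inner maximum is attained for every
   feasible solution, so it cannot hold vacuously. *)
Definition optimal (F : binvec n -> binvec n -> Prop) (x y : binvec n) (v : R)
    : Prop :=
  [/\ F x y,
      robust_cost x y v
    & forall x' y', F x' y' -> exists2 v', robust_cost x' y' v' & v <= v'].

End Objective.

Local Open Scope nat_scope.

(** * The machine model

   A unit-cost random access machine presented as a structured language.  The
   memory consists of arrays of natural numbers (indices, counters, bits) and
   arrays of rationals, each named by a literal and unbounded; a scalar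
   variable is an array used at index 0.  Rationals can be combined by field
   operations and compared, but never converted into natural numbers, so no
   rounding is available.  A program is a finite text, fixed once for all
   input sizes. *)

Inductive iexp :=
| INum of nat
| IGet of nat & iexp
| IAdd of iexp & iexp
| ISub of iexp & iexp
| IMul of iexp & iexp.

Inductive qexp :=
| QNum of rat
| QGet of nat & iexp
| QAdd of qexp & qexp
| QSub of qexp & qexp
| QMul of qexp & qexp
| QDiv of qexp & qexp.

Inductive test :=
| ILe of iexp & iexp
| QLe of qexp & qexp.

Inductive cmd :=
| Skip
| ISet of nat & iexp & iexp
| QSet of nat & iexp & qexp
| Seq of cmd & cmd
| If of test & cmd & cmd
| While of test & cmd
| Call of nat.

(* [Call j] executes the [j]-th procedure on the shared memory; recursion is
   allowed.  Execution starts with procedure 0. *)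
Definition program := seq cmd.

Record state := State {
  imem : nat -> nat -> nat;
  qmem : nat -> nat -> rat
}.

Definition update T (m : nat -> nat -> T) (a i : nat) (v : T)
    : nat -> nat -> T :=
  fun b j => if (b == a) && (j == i) then v else m b j.

Fixpoint ieval (s : state) (e : iexp) : nat :=
  match e with
  | INum m => m
  | IGet a e1 => imem s a (ieval s e1)
  | IAdd e1 e2 => ieval s e1 + ieval s e2
  | ISub e1 e2 => ieval s e1 - ieval s e2
  | IMul e1 e2 => ieval s e1 * ieval s e2
  end.

Fixpoint qeval (s : state) (e : qexp) : rat :=
  match e with
  | QNum q => q
  | QGet a e1 => qmem s a (ieval s e1)
  | QAdd e1 e2 => (qeval s e1 + qeval s e2)%R
  | QSub e1 e2 => (qeval s e1 - qeval s e2)%R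
  | QMul e1 e2 => (qeval s e1 * qeval s e2)%R
  | QDiv e1 e2 => (qeval s e1 / qeval s e2)%R
  end.

Definition teval (s : state) (b : test) : bool :=
  match b with
  | ILe e1 e2 => ieval s e1 <= ieval s e2
  | QLe e1 e2 => (qeval s e1 <= qeval s e2)%R
  end.

(* Every operation, comparison, literal, memory access and control step is
   charged one time unit. *)
Fixpoint icost (e : iexp) : nat :=
  match e with
  | INum _ => 1
  | IGet _ e1 => (icost e1).+1
  | IAdd e1 e2 | ISub e1 e2 | IMul e1 e2 => (icost e1 + icost e2).+1
  end.

Fixpoint qcost (e : qexp) : nat :=
  match e with
  | QNum _ => 1
  | QGet _ e1 => (icost e1).+1
  | QAdd e1 e2 | QSub e1 e2 | QMul e1 e2 | QDiv e1 e2 =>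
      (qcost e1 + qcost e2).+1
  end.

Definition tcost (b : test) : nat :=
  match b with
  | ILe e1 e2 => (icost e1 + icost e2).+1
  | QLe e1 e2 => (qcost e1 + qcost e2).+1
  end.

(* [exec P c s t s']: started in [s], command [c] halts in [s'] after exactly
   [t] time units.  The relation is deterministic in [t] and [s']. *)
Inductive exec (P : program) : cmd -> state -> nat -> state -> Prop :=
| exec_skip s :
    exec P Skip s 1 s
| exec_iset s a e1 e2 :
    exec P (ISet a e1 e2) s (icost e1 + icost e2).+1
      (State (update (imem s) a (ieval s e1) (ieval s e2)) (qmem s))
| exec_qset s a e1 e2 :
    exec P (QSet a e1 e2) s (icost e1 + qcost e2).+1
      (State (imem s) (update (qmem s) a (ieval s e1) (qeval s e2)))
| exec_seq s s1 s2 t1 t2 c1 c2 :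
    exec P c1 s t1 s1 -> exec P c2 s1 t2 s2 ->
    exec P (Seq c1 c2) s (t1 + t2) s2
| exec_if s s1 t b c1 c2 :
    exec P (if teval s b then c1 else c2) s t s1 ->
    exec P (If b c1 c2) s (tcost b + t) s1
| exec_while_stop s b c :
    ~~ teval s b ->
    exec P (While b c) s (tcost b) s
| exec_while_step s s1 s2 t1 t2 b c :
    teval s b -> exec P c s t1 s1 -> exec P (While b c) s1 t2 s2 ->
    exec P (While b c) s (tcost b + t1 + t2) s2
| exec_call s s1 t j :
    exec P (nth Skip P j) s t s1 ->
    exec P (Call j) s t.+1 s1.

(** * Input and output conventions

   Input: the size parameters [ps] are the first cells of integer array 0; the
   vectors of fixed costs, nominal costs and deviations are rational arrays
   0, 1, 2, and the budget is cell 0 of rational array 3.  All other cells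
   contain 0.
   Output: the vectors [x] and [y] are written as bits to integer arrays 1
   and 2, and the optimal value to cell 0 of rational array 4. *)

Definition cells n (v : {ffun 'I_n -> rat}) (j : nat) : rat :=
  oapp v 0%R (insub j : option 'I_n).

Definition input n (I : instance n) (ps : seq nat) : state :=
  State
    (fun a j => if a is 0 then nth 0 ps j else 0)
    (fun a j =>
       match a with
       | 0 => cells (fixed_cost I) j
       | 1 => cells (nominal_cost I) j
       | 2 => cells (deviation I) j
       | 3 => if j is 0 then budget I else 0%R
       | _ => 0%R
       end).

Definition outputs n (s : state) (x y : binvec n) (v : rat) : Prop :=
  [/\ forall i : 'I_n, imem s 1 i = x i,
      forall i : 'I_n, imem s 2 i = y i
    & qmem s 4 0 = v].

Definition solves_within (R : realType) n (P : program) (ps : seq nat)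
    (I : instance n) (F : binvec n -> binvec n -> Prop) (T : nat) : Prop :=
  exists (t : nat) (s : state) (x y : binvec n) (v : rat),
    [/\ exec P (Call 0) (input I ps) t s,
        t <= T,
        outputs s x y v
      & optimal I F x y (ratr v : R)].

(* Main.v *)
Require Import Defs.
From mathcomp Require Import all_boot all_order all_algebra zify.
From mathcomp Require Import classical_sets reals.

(** For a fixed [y] the adversary gains [min (Gamma, d y)], so the robust cost is
the smaller of the linear costs [C x + (c + f d) y + (1 - f) Gamma] for [f = 0]
and [f = 1], and it suffices to minimise both linear costs over the feasible set.

Over F(p), item [i] costs [min (C_i, c_i + f d_i)] when it is taken, and the [p]
cheapest items are found from the [p]-th smallest cost, computed by the median of
medians algorithm with groups of five.

Over F(p,k), a solution with [u] items in [x] only has [u] items in [y] only and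
[p - u] common ones, where [u <= k].  A table indexed by the number of items seen
and by the numbers of items in [x] only, in [y] only and in both has
[(n + 1) (k + 1)^2 (p + 1)] entries, each computed from at most four others. *)

Set Implicit Arguments.
Unset Strict Implicit.
Unset Printing Implicit Defensive.

Import Order.TTheory GRing.Theory Num.Theory.

(** * Reasoning about execution time *)

(** The running time is a claim about a fixed program text, so every routine is given a
    total-correctness triple with an explicit time bound. Memory is global and procedures have no
    local variables. Hence each working scalar occupies an array of its own, and what a routine
    preserves is read off from the names of the arrays it writes. Only the non-tail recursive call
    of the selection must save data, which is why a stack is kept by hand. Both solvers are analysed
    for arbitrary costs [A] of [x] and [B] of [y]; one procedure then serves both values of [f],
    which it reads from a memory cell. Optimality needs no exchange of items. The threshold acts as
    a Lagrange multiplier for the cardinality constraint. The table satisfies local Bellman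
    equations, which are read once as a lower bound for every solution and once along the recorded
    choices. The final bounds carry no additive constant: positivity of [p] (and of [k]) makes the
    bounding product at least 1, so fixed overheads are absorbed by the factor. *)

Notation "c1 ;; c2" := (Seq c1 c2) (at level 60, right associativity).
Notation "'#' m" := (INum m) (at level 8).
Notation "'i[' a ']'" := (IGet a (INum 0)) (at level 8).
Notation "'q[' a ']'" := (QGet a (INum 0)) (at level 8).
Notation "a ':=i' e" := (ISet a (INum 0) e) (at level 55).
Notation "a ':=q' e" := (QSet a (INum 0) e) (at level 55).
Notation "e1 '+i' e2" := (IAdd e1 e2) (at level 50, left associativity).
Notation "e1 '-i' e2" := (ISub e1 e2) (at level 50, left associativity).
Notation "e1 '*i' e2" := (IMul e1 e2) (at level 40, left associativity).
Notation ILt e1 e2 := (ILe (IAdd e1 (INum 1)) e2).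

Definition runs P c s T (Q : state -> Prop) :=
  exists t s', [/\ exec P c s t s', t <= T & Q s'].

Fixpoint straight (c : cmd) : bool :=
  match c with
  | Skip | ISet _ _ _ | QSet _ _ _ => true
  | Seq c1 c2 | If _ c1 c2 => straight c1 && straight c2
  | While _ _ | Call _ => false
  end.

(** The last branch is correct for [Skip] only; loops and calls also fall into it, and [straight]
    excludes them wherever [wp] and [max_cost] are applied. *)
Fixpoint wp (c : cmd) (Q : state -> Prop) (s : state) : Prop :=
  match c with
  | ISet a e1 e2 =>
      Q (State (update (imem s) a (ieval s e1) (ieval s e2)) (qmem s))
  | QSet a e1 e2 =>
      Q (State (imem s) (update (qmem s) a (ieval s e1) (qeval s e2)))
  | Seq c1 c2 => wp c1 (wp c2 Q) s
  | If b c1 c2 => if teval s b then wp c1 Q s else wp c2 Q s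
  | _ => Q s
  end.

Fixpoint max_cost (c : cmd) : nat :=
  match c with
  | ISet _ e1 e2 => (icost e1 + icost e2).+1
  | QSet _ e1 e2 => (icost e1 + qcost e2).+1
  | Seq c1 c2 => max_cost c1 + max_cost c2
  | If b c1 c2 => tcost b + maxn (max_cost c1) (max_cost c2)
  | _ => 1
  end.

Section Runs.
Variable P : program.
Implicit Types (c : cmd) (s : state) (b : test) (Q : state -> Prop).

Lemma runs_weaken c s T T' Q Q' :
  runs P c s T Q -> T <= T' -> (forall s', Q s' -> Q' s') -> runs P c s T' Q'.
Proof.
move=> [t [s' [ex le_t Qs']]] le_T QQ'; exists t, s'; split=> //.
  exact: leq_trans le_T.
exact: QQ'.
Qed.

Lemma runs_straight c s T Q :
  straight c -> max_cost c <= T -> wp c Q s -> runs P c s T Q.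
Proof.
elim: c s T Q => //=.
- by move=> s T Q _ le_T Qs; exists 1, s; split=> //; apply: exec_skip.
- move=> a e1 e2 s T Q _ le_T Qs; do 2!eexists.
  by split; [exact: exec_iset | | exact: Qs].
- move=> a e1 e2 s T Q _ le_T Qs; do 2!eexists.
  by split; [exact: exec_qset | | exact: Qs].
- move=> c1 IH1 c2 IH2 s T Q /andP[st1 st2] le_T w.
  have [t1 [s1 [ex1 le1 w1]]] := IH1 s _ _ st1 (leqnn _) w.
  have [t2 [s2 [ex2 le2 w2]]] := IH2 s1 _ _ st2 (leqnn _) w1.
  exists (t1 + t2), s2; split=> //; first exact: exec_seq ex1 ex2.
  by apply: leq_trans le_T; apply: leq_add.
- move=> b c1 IH1 c2 IH2 s T Q /andP[st1 st2] le_T w.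
  have [t [s' [ex le_t Qs]]] : runs P (if teval s b then c1 else c2) s
      (maxn (max_cost c1) (max_cost c2)) Q.
    by case: ifP w => _; [apply: IH1 | apply: IH2]; rewrite // leq_max leqnn ?orbT.
  exists (tcost b + t), s'; split=> //; first exact: exec_if.
  by apply: leq_trans le_T; rewrite leq_add2l.
Qed.

Lemma runs_seq c1 c2 s T1 T2 T Q :
  runs P c1 s T1 (fun s1 => runs P c2 s1 T2 Q) -> T1 + T2 <= T ->
  runs P (c1 ;; c2) s T Q.
Proof.
move=> [t1 [s1 [ex1 le1 [t2 [s2 [ex2 le2 Qs]]]]]] le_T.
exists (t1 + t2), s2; split=> //; first exact: exec_seq ex1 ex2.
by apply: leq_trans le_T; apply: leq_add.
Qed.

Lemma runs_if b c1 c2 s T T' Q :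
  (teval s b -> runs P c1 s T Q) -> (~~ teval s b -> runs P c2 s T Q) ->
  tcost b + T <= T' -> runs P (If b c1 c2) s T' Q.
Proof.
move=> r1 r2 le_T.
have [t [s' [ex le_t Qs]]] : runs P (if teval s b then c1 else c2) s T Q.
  by case: ifP => E; [apply: r1 | apply: r2; rewrite E].
exists (tcost b + t), s'; split=> //; first exact: exec_if.
by apply: leq_trans le_T; rewrite leq_add2l.
Qed.

Lemma runs_call j s T T' Q :
  runs P (nth Skip P j) s T Q -> T < T' -> runs P (Call j) s T' Q.
Proof.
move=> [t [s' [ex le_t Qs]]] le_T.
exists t.+1, s'; split=> //; first exact: exec_call.
exact: leq_ltn_trans le_T.
Qed.

Lemma runs_for (Inv : nat -> state -> Prop) N Tb b c s T Q :
  Inv 0 s ->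
  (forall j s', j < N -> Inv j s' ->
     teval s' b /\ runs P c s' Tb (Inv j.+1)) ->
  (forall s', Inv N s' -> ~~ teval s' b) ->
  N * (tcost b + Tb) + tcost b <= T ->
  (forall s', Inv N s' -> Q s') ->
  runs P (While b c) s T Q.
Proof.
move=> Inv0 step stop le_T IQ.
suff H : forall m j s', m + j = N -> Inv j s' ->
    exists t s2, [/\ exec P (While b c) s' t s2,
      t <= m * (tcost b + Tb) + tcost b & Inv N s2].
  have [t [s2 [ex le_t Is2]]] := H N 0 s (addn0 _) Inv0.
  by exists t, s2; split; [| apply: leq_trans le_T | apply: IQ].
elim=> [|m IH] j s' Ej Ij.
  rewrite add0n in Ej; subst j; exists (tcost b), s'; split=> //.
  by apply: exec_while_stop; apply: stop.
have lt_j : j < N by lia.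
have [tb [t1 [s1 [ex1 le1 I1]]]] := step j s' lt_j Ij.
have [|t2 [s2 [ex2 le2 I2]]] := IH j.+1 s1 _ I1; first by lia.
exists (tcost b + t1 + t2), s2; split=> //; first exact: exec_while_step ex1 ex2.
by rewrite mulSn; lia.
Qed.

(** * Frame conditions from syntactic write sets *)

Fixpoint writes_in (calls wi wq : pred nat) (c : cmd) : bool :=
  match c with
  | Skip => true
  | ISet a _ _ => wi a
  | QSet a _ _ => wq a
  | Seq c1 c2 | If _ c1 c2 => writes_in calls wi wq c1 && writes_in calls wi wq c2
  | While _ c1 => writes_in calls wi wq c1
  | Call j => calls j
  end.

Definition agree (wi wq : pred nat) (s s' : state) : Prop :=
  (forall a, ~~ wi a -> imem s' a = imem s a) /\
  (forall a, ~~ wq a -> qmem s' a = qmem s a).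

(** The induction is on the execution, not on the command. A recursive call is then covered by the
    induction hypothesis, once every procedure in [calls] is known to respect the same write
    sets. *)
Lemma exec_frame (calls wi wq : pred nat) c s t s' :
  (forall j, calls j -> writes_in calls wi wq (nth Skip P j)) ->
  writes_in calls wi wq c -> exec P c s t s' -> agree wi wq s s'.
Proof.
move=> wP wc ex; elim: ex wc => {c s t s'} //=.
- move=> s a e1 e2 wa; split=> // a' wa'; rewrite /update /=.
  by case: eqP => // E; rewrite E wa in wa'.
- move=> s a e1 e2 wa; split=> // a' wa'; rewrite /update /=.
  by case: eqP => // E; rewrite E wa in wa'.
- move=> s s1 s2 t1 t2 c1 c2 _ IH1 _ IH2 /andP[/IH1[i1 q1] /IH2[i2 q2]].
  by split=> a wa; [rewrite i2 // i1 | rewrite q2 // q1].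
- by move=> s s1 t b c1 c2 _ IH /andP[w1 w2]; apply: IH; case: ifP.
- move=> s s1 s2 t1 t2 b c _ _ IH1 _ IH2 wc.
  have [i1 q1] := IH1 wc; have [i2 q2] := IH2 wc.
  by split=> a wa; [rewrite i2 // i1 | rewrite q2 // q1].
- by move=> s s1 t j _ IH cj; apply/IH/wP.
Qed.

Lemma runs_frame (calls wi wq : pred nat) c s T Q :
  (forall j, calls j -> writes_in calls wi wq (nth Skip P j)) ->
  writes_in calls wi wq c -> runs P c s T Q ->
  runs P c s T (fun s' => Q s' /\ agree wi wq s s').
Proof.
move=> wP wc [t [s' [ex le_t Qs]]]; exists t, s'; split=> //.
by split=> //; apply: exec_frame wP wc ex.
Qed.

Lemma agree_trans wi wq s1 s2 s3 :
  agree wi wq s1 s2 -> agree wi wq s2 s3 -> agree wi wq s1 s3.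
Proof.
by move=> [i1 q1] [i2 q2]; split=> a wa; [rewrite i2 // i1 | rewrite q2 // q1].
Qed.

(** Agreement with the state before the loop joins the invariant automatically, so [Inv] has to
    speak only of the data that change. *)
Lemma runs_for_frame (calls wi wq : pred nat) (Inv : nat -> state -> Prop)
    N Tb b c s T (Q : state -> Prop) :
  (forall j, calls j -> writes_in calls wi wq (nth Skip P j)) ->
  writes_in calls wi wq c ->
  Inv 0 s ->
  (forall j s', j < N -> agree wi wq s s' -> Inv j s' ->
     teval s' b /\ runs P c s' Tb (Inv j.+1)) ->
  (forall s', agree wi wq s s' -> Inv N s' -> ~~ teval s' b) ->
  N * (tcost b + Tb) + tcost b <= T ->
  (forall s', agree wi wq s s' -> Inv N s' -> Q s') ->
  runs P (While b c) s T Q.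
Proof.
move=> wP wc Inv0 step stop le_T IQ.
apply: (@runs_for (fun j s' => agree wi wq s s' /\ Inv j s') N Tb) => //.
- move=> j s' lt_j [fr Ij]; have [tb r] := step j s' lt_j fr Ij; split=> //.
  apply: runs_weaken (runs_frame wP wc r) (leqnn _) _ => s2 [I2 fr2].
  by split=> //; apply: agree_trans fr fr2.
- by move=> s' [fr Is]; apply: stop.
- by move=> s' [fr Is]; apply: IQ.
Qed.

End Runs.

Definition no_calls : pred nat := xpred0.

Lemma no_callsP P wi wq j :
  no_calls j -> writes_in no_calls wi wq (nth Skip P j).
Proof. by []. Qed.

Notation among l := (fun a : nat => a \in (l : seq nat)).

(** * Linear-time selection *)

Definition seg (f : nat -> rat) b n : seq rat := mkseq (fun j => f (b + j)) n.

Arguments seg : simpl never.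

(** With [k] counted from 0, this characterises the entry at position [k] of the sorted sequence by
    value alone, so repeated values need no tie-breaking. *)
Definition has_rank (xs : seq rat) k v :=
  count (fun x => x < v)%R xs <= k < count (fun x => x <= v)%R xs.

Lemma segS f b n : seg f b n.+1 = rcons (seg f b n) (f (b + n)).
Proof. by rewrite /seg mkseqS. Qed.

Lemma size_seg f b n : size (seg f b n) = n.
Proof. exact: size_mkseq. Qed.

Lemma nth_seg f b n j : j < n -> nth 0%R (seg f b n) j = f (b + j).
Proof. exact: nth_mkseq. Qed.

Lemma eq_seg f g b n :
  (forall j, b <= j < b + n -> f j = g j) -> seg f b n = seg g b n.
Proof.
move=> eq_fg; apply/eq_in_map => j; rewrite mem_iota => /andP[_ lt_j].
by apply: eq_fg; lia.
Qed.

Lemma count_rcons (T : Type) (p : pred T) xs x :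
  count p (rcons xs x) = count p xs + p x.
Proof. by rewrite -cats1 count_cat /= addn0. Qed.

Lemma rank_exists xs k : k < size xs ->
  exists2 j, j < size xs & has_rank xs k (nth 0%R xs j).
Proof.
move=> lt_k; pose ys := sort <=%O xs; pose v := nth 0%R ys k.
have perm_ys : perm_eq ys xs by rewrite perm_sort.
have sz : size ys = size xs by rewrite size_sort.
have sorted_ys : sorted <=%O ys by apply: sort_le_sorted.
have v_xs : v \in xs by rewrite -(perm_mem perm_ys) mem_nth ?sz.
have mono i j : i <= j -> j < size ys -> (nth 0%R ys i <= nth 0%R ys j)%R.
  move=> le_ij lt_j; apply: (sorted_leq_nth le_trans lexx) => //.
  by rewrite inE; apply: leq_ltn_trans lt_j.
exists (index v xs); first by rewrite index_mem.
rewrite nth_index // /has_rank -!(permP perm_ys); apply/andP; split.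
  rewrite -[ys](cat_take_drop k) count_cat.
  suff -> : count (fun x => x < v)%R (drop k ys) = 0.
    by rewrite addn0 (leq_trans (count_size _ _)) // size_takel // sz ltnW.
  apply/eqP; rewrite -leqn0 leqNgt -has_count; apply/hasPn => x.
  move=> /(nthP 0%R)[i]; rewrite size_drop nth_drop => lt_i <-.
  by rewrite -leNgt; apply: mono; [exact: leq_addr | rewrite sz; move: lt_i; rewrite sz ltn_subRL].
suff H : k.+1 <= count (fun x => x <= v)%R (take k.+1 ys).
  by rewrite -[ys](cat_take_drop k.+1) count_cat; apply: leq_trans H (leq_addr _ _).
have : all (fun x => x <= v)%R (take k.+1 ys).
  apply/(all_nthP 0%R) => i; rewrite size_takel ?sz // => lt_i.
  by rewrite nth_take //; apply: mono; rewrite ?sz.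
by rewrite all_count => /eqP ->; rewrite size_takel ?sz.
Qed.

(* Integer cells: 18 and 19 candidate and comparison counters, 20 and 21 the
   numbers of elements below / not above the candidate, 26-28 the arguments
   (offset, length, rank).  Rational cells: 12 result, 14 candidate; array 10 is
   the workspace shared with [select]. *)
Definition small_select_body :=
  (14 :=q QGet 10 (i[26] +i i[18]) ;;
   19 :=i #0 ;; 20 :=i #0 ;; 21 :=i #0) ;;
  While (ILt i[19] i[27])
    (If (QLe q[14] (QGet 10 (i[26] +i i[19]))) Skip (20 :=i i[20] +i #1) ;;
     If (QLe (QGet 10 (i[26] +i i[19])) q[14]) (21 :=i i[21] +i #1) Skip ;;
     19 :=i i[19] +i #1) ;;
  If (ILe i[20] i[28]) (If (ILt i[28] i[21]) (12 :=q q[14]) Skip) Skip ;;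
  18 :=i i[18] +i #1.

Definition small_select :=
  18 :=i #0 ;; While (ILt i[18] i[27]) small_select_body.

Ltac step := rewrite /= /update /=.

(** Every entry is tried as a candidate and compared with all others. The quadratic cost is harmless
    because the procedure is used on at most five entries. *)
Lemma small_select_runs P s b n k :
  imem s 26 0 = b -> imem s 27 0 = n -> imem s 28 0 = k -> k < n ->
  runs P small_select s (10 + n * (100 + n * 60))
    (fun s' => has_rank (seg (qmem s 10) b n) k (qmem s' 12 0)).
Proof.
move=> Eb En Ek lt_kn; set xs := seg _ _ _.
apply: (@runs_seq _ _ _ _ 3 (7 + n * (100 + n * 60))); last lia.
apply: runs_straight => //; step.
set s0 := State _ _.
(* The result cell means something only after a candidate of the right rank has been met;
   [rank_exists] discharges this premise when the loop ends. *)
pose Inv j (s' : state) := imem s' 18 0 = j /\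
  ((exists2 i, i < j & has_rank xs k (nth 0%R xs i)) ->
    has_rank xs k (qmem s' 12 0)).
apply: (@runs_for_frame _ no_calls (among [:: 18; 19; 20; 21])
  (among [:: 12; 14]) Inv n (90 + n * 60)) => //.
- by split=> // -[i].
- move=> j s1 lt_j [fi fq] [Ej IH].
  have E26 := fi 26 isT; have E27 := fi 27 isT; have E28 := fi 28 isT.
  have E10 := fq 10 isT; rewrite /s0 /update /= in E26 E27 E28 E10.
  split; first by rewrite /= Ej E27 En addn1.
  pose c := nth 0%R xs j; have Ec : c = qmem s1 10 (b + j) by rewrite E10 /c nth_seg.
  apply: (@runs_seq _ _ _ _ 20 (70 + n * 60)); last lia.
  apply: runs_straight => //; step.
  apply: (@runs_seq _ _ _ _ (6 + n * 60) 55); last lia.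
  set s2 := State _ _.
  pose Inv2 r (s' : state) := [/\ imem s' 19 0 = r,
    imem s' 20 0 = count (fun x => x < c)%R (seg (qmem s 10) b r)
    & imem s' 21 0 = count (fun x => x <= c)%R (seg (qmem s 10) b r)].
  apply: (@runs_for_frame _ no_calls (among [:: 19; 20; 21]) xpred0 Inv2 n 44) => //.
  + move=> r s3 lt_r [gi gq] [Er E20 E21].
    have G26 := gi 26 isT; have G27 := gi 27 isT.
    have G10 := gq 10 isT; have G14 := gq 14 isT.
    rewrite /s2 /update /= in G26 G27 G10 G14.
    split; first by rewrite /= Er G27 E27 En addn1.
    apply: runs_straight => //; step.
    rewrite Er G26 E26 Eb G10 G14 Ej E26 Eb -Ec E10.
    rewrite /Inv2 segS !count_rcons -E20 -E21.
    step; case: leP => Hl; case: leP => Hr; step; rewrite ?Er ?addn0 ?addn1 //.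
  + move=> s3 [gi gq] [Er _ _]; rewrite /= Er.
    have G27 := gi 27 isT; rewrite /s2 /update /= in G27.
    by rewrite G27 E27 En addn1 ltnn.
  + by rewrite /=; lia.
  move=> s3 [gi gq] [Er E20 E21].
  have G28 := gi 28 isT; have G18 := gi 18 isT; have G12 := gq 12 isT.
  have G14 := gq 14 isT; rewrite /s2 /update /= in G28 G18 G12 G14.
  apply: runs_straight => //; step.
  rewrite E20 E21 G28 E28 Ek addn1 /Inv.
  have rank_c : has_rank xs k c =
     (count (fun x => x < c)%R xs <= k) && (k < count (fun x => x <= c)%R xs) by [].
  case: ifP => H1; [case: ifP => H2|]; step; rewrite ?addn1 G18 Ej; split=> //.
  + by rewrite G14 Ej E26 Eb -Ec rank_c H1 H2.
  + move=> [i lt_i ri]; rewrite G12; apply: IH; exists i => //.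
    rewrite ltnS leq_eqVlt in lt_i; case/orP: lt_i => // /eqP Ei.
    by move: ri; rewrite Ei rank_c H1 H2.
  + move=> [i lt_i ri]; rewrite G12; apply: IH; exists i => //.
    rewrite ltnS leq_eqVlt in lt_i; case/orP: lt_i => // /eqP Ei.
    by move: ri; rewrite Ei rank_c H1.
- move=> s1 [fi fq] [Ej _]; have := fi 27 isT; rewrite /s0 /update /= => E27.
  by rewrite Ej E27 En addn1 ltnn.
- by rewrite /=; lia.
move=> s1 _ [_]; apply.
by have := @rank_exists xs k; rewrite size_seg; apply.
Qed.

(** * Group medians and partition around a pivot *)

Lemma seg_cat f b n1 n2 : seg f b (n1 + n2) = seg f b n1 ++ seg f (b + n1) n2.
Proof.
rewrite /seg /mkseq iotaD map_cat; congr (_ ++ _).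
rewrite add0n -{1}(addn0 n1) iotaDl -map_comp.
by apply: eq_map => j /=; rewrite addnA.
Qed.

Lemma count_ge (v : rat) xs :
  count (fun x => v <= x)%R xs = size xs - count (fun x => x < v)%R xs.
Proof.
rewrite -(count_predC (fun x => x < v)%R xs) addKn.
by apply: eq_count => x /=; rewrite -leNgt.
Qed.

Lemma count_gt (v : rat) xs :
  count (fun x => v < x)%R xs = size xs - count (fun x => x <= v)%R xs.
Proof.
rewrite -(count_predC (fun x => x <= v)%R xs) addKn.
by apply: eq_count => x /=; rewrite -ltNge.
Qed.

(** The groups are disjoint blocks of the segment, so the contributions of three elements add up;
    entries after the last full group can only increase the count. *)
Lemma group_count (p q : pred rat) f g b n m : 5 * m <= n ->
  (forall i, i < m -> q (g i) -> 3 <= count p (seg f (b + 5 * i) 5)) ->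
  3 * count q (mkseq g m) <= count p (seg f b n).
Proof.
move=> le_n grp; rewrite -(subnKC le_n) seg_cat count_cat.
apply: leq_trans (leq_addr _ _); elim: m {le_n} grp => // m IH grp.
rewrite mkseqS count_rcons mulnDr mulnSr seg_cat count_cat leq_add //.
  by apply: IH => i lt_i; apply: grp; rewrite ltnS ltnW.
by have := grp m (leqnn _); case: (q (g m)) => // ->.
Qed.

(* Cell 15 is the parity of the group counter 14; it lets cell 29 follow half of
   the counter, since the machine has no integer division. *)
Definition medians :=
  (14 :=i #0 ;; 15 :=i #0 ;; 29 :=i #0) ;;
  While (ILe (#5 *i i[14] +i #5) i[12])
    ((26 :=i i[11] +i #5 *i i[14] ;; 27 :=i #5 ;; 28 :=i #2) ;;
     Call 3 ;;
     (QSet 10 (i[11] +i i[12] +i i[14]) q[12] ;;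
      29 :=i i[29] +i i[15] ;; 15 :=i #1 -i i[15] ;; 14 :=i i[14] +i #1)).

(* The segment starts at cell 11 and has length cell 12.  Its small elements are
   copied to the [n] cells after it and the large ones to the next [n] cells, so
   that either side can be searched in place. *)
Definition pivot_partition :=
  (14 :=i #0 ;; 16 :=i #0 ;; 17 :=i #0) ;;
  While (ILt i[14] i[12])
    (13 :=q QGet 10 (i[11] +i i[14]) ;;
     If (QLe q[13] q[11])
       (If (QLe q[11] q[13]) Skip
          (QSet 10 (i[11] +i i[12] +i i[16]) q[13] ;; 16 :=i i[16] +i #1))
       (QSet 10 (i[11] +i #2 *i i[12] +i i[17]) q[13] ;; 17 :=i i[17] +i #1) ;;
     14 :=i i[14] +i #1).

Section Select.
Variable P : program.
Hypothesis P3 : nth Skip P 3 = small_select.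

Lemma medians_runs s b n :
  imem s 11 0 = b -> imem s 12 0 = n ->
  runs P medians s (440 * n + 40) (fun s' =>
    [/\ imem s' 14 0 = n %/ 5, imem s' 29 0 = (n %/ 5)./2,
        forall g, g < n %/ 5 ->
          has_rank (seg (qmem s 10) (b + 5 * g) 5) 2 (qmem s' 10 (b + n + g))
      & forall j, j < b + n -> qmem s' 10 j = qmem s 10 j]).
Proof.
move=> Eb En.
apply: (@runs_seq _ _ _ _ 9 (440 * n + 30)); last lia.
apply: runs_straight => //; step; set s0 := State _ _.
pose Inv g (s' : state) := [/\ imem s' 14 0 = g, imem s' 15 0 = odd g,
  imem s' 29 0 = g./2,
  forall g', g' < g ->
    has_rank (seg (qmem s 10) (b + 5 * g') 5) 2 (qmem s' 10 (b + n + g'))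
  & forall j, j < b + n -> qmem s' 10 j = qmem s 10 j].
(* Of the 2100 units per group, 2010 pay for [small_select] on five entries; this is about 420 per
   entry of the segment. *)
apply: (@runs_for_frame _ (pred1 3)
  (among [:: 14; 15; 18; 19; 20; 21; 26; 27; 28; 29])
  (among [:: 10; 12; 14]) Inv (n %/ 5) 2100) => //.
- by move=> j /eqP ->; rewrite P3.
- move=> g s1 lt_g [fi fq] [E14 E15 E29 Er Ej].
  have E11 := fi 11 isT; have E12 := fi 12 isT.
  rewrite /s0 /update /= in E11 E12.
  have le_g : 5 * g + 5 <= n.
    by have := leq_trunc_div n 5; move: lt_g; lia.
  split; first by rewrite /= E14 E12 En.
  apply: (@runs_seq _ _ _ _ 20 2050); last lia.
  apply: runs_straight => //; step; set s2 := State _ _.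
  apply: (@runs_seq _ _ _ _ 2011 39); last lia.
  apply: (@runs_call _ _ _ 2010); last lia.
  rewrite P3.
  have r3 := @small_select_runs P s2 (b + 5 * g) 5 2.
  have {r3} r3 : runs P small_select s2 2010 (fun s' =>
      has_rank (seg (qmem s2 10) (b + 5 * g) 5) 2 (qmem s' 12 0)).
    apply: runs_weaken (r3 _ _ _ _) _ _ => //.
    by rewrite /s2 /update /= E11 Eb E14.
  have {r3} r3 := runs_frame (c := small_select) (calls := no_calls) (wi := among [:: 18; 19; 20; 21])
    (wq := among [:: 12; 14]) (@no_callsP P _ _) isT r3.
  apply: runs_weaken r3 (leqnn _) _ => s3 [rk [gi gq]].
  have G11 := gi 11 isT; have G12 := gi 12 isT; have G14 := gi 14 isT.
  have G15 := gi 15 isT; have G29 := gi 29 isT; have G10 := gq 10 isT.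
  rewrite /s2 /update /= in G11 G12 G14 G15 G29 G10.
  apply: runs_straight => //; rewrite /Inv; step.
  rewrite G11 G12 G14 G15 G29 G10 E11 E12 E14 E15 E29 Eb En.
  split => //=.
  + by rewrite addn1.
  + by case: (odd g).
  + by rewrite uphalf_half addnC.
  + move=> g' lt_g'; rewrite eqn_add2l; case: eqP => [->|ne_g].
      move: rk; rewrite (@eq_seg _ (qmem s 10)) // => j /andP[_ lt_j].
      by rewrite /s2 /= Ej //; lia.
    by apply: Er; lia.
  + by move=> j lt_j; case: eqP => [|_]; [lia | apply: Ej].
- move=> s1 [fi fq] [E14 _ _ _ _]; have := fi 12 isT.
  rewrite /s0 /update /= => E12; rewrite E14 E12 En -ltnNge.
  by have := ltn_ceil n (isT : 0 < 5); lia.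
- by rewrite /=; have := leq_trunc_div n 5; lia.
by move=> s1 _ [E14 _ E29 Er Ej].
Qed.

Lemma pivot_partition_runs s b n v :
  imem s 11 0 = b -> imem s 12 0 = n -> qmem s 11 0 = v ->
  runs P pivot_partition s (80 * n + 40) (fun s' =>
    let xs := seg (qmem s 10) b n in
    [/\ imem s' 16 0 = count (fun x => x < v)%R xs,
        imem s' 17 0 = count (fun x => v < x)%R xs,
        seg (qmem s' 10) (b + n) (imem s' 16 0) = filter (fun x => x < v)%R xs,
        seg (qmem s' 10) (b + 2 * n) (imem s' 17 0) = filter (fun x => v < x)%R xs
      & forall j, j < b + n -> qmem s' 10 j = qmem s 10 j]).
Proof.
move=> Eb En Ev; rewrite /=.
apply: (@runs_seq _ _ _ _ 9 (80 * n + 31)); last lia.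
apply: runs_straight => //; step; set s0 := State _ _.
pose Inv r (s' : state) :=
  let xs := seg (qmem s 10) b r in
  [/\ imem s' 14 0 = r,
    imem s' 16 0 = count (fun x => x < v)%R xs /\
    imem s' 17 0 = count (fun x => v < x)%R xs,
    seg (qmem s' 10) (b + n) (imem s' 16 0) = filter (fun x => x < v)%R xs,
    seg (qmem s' 10) (b + 2 * n) (imem s' 17 0) = filter (fun x => v < x)%R xs
  & forall j, j < b + n -> qmem s' 10 j = qmem s 10 j].
apply: (@runs_for_frame _ no_calls (among [:: 14; 16; 17])
  (among [:: 10; 13]) Inv n 60) => //.
- move=> r s1 lt_r [fi fq] [E14 [E16 E17] S1 S2 Ej].
  have E11 := fi 11 isT; have E12 := fi 12 isT; have F11 := fq 11 isT.
  rewrite /s0 /update /= in E11 E12 F11.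
  split; first by rewrite /= E14 E12 En addn1.
  apply: runs_straight => //; step.
  rewrite E14 E11 E12 F11 Eb En Ev Ej ?ltn_add2l //.
  have le16 : imem s1 16 0 <= r.
    by rewrite E16 -[X in _ <= X](size_seg (qmem s 10) b r) count_size.
  have le17 : imem s1 17 0 <= r.
    by rewrite E17 -[X in _ <= X](size_seg (qmem s 10) b r) count_size.
  rewrite /Inv segS !count_rcons !filter_rcons.
  move: E16 E17 S1 S2 le16 le17.
  move Ew1: (imem s1 16 0) => w1; move Ew2: (imem s1 17 0) => w2.
  move=> <- <- S1 S2 le1 le2.
  set x := qmem s 10 (b + r).
  case: (ltgtP x v) => Hx; step; rewrite !(addn0, addn1) ?Ew1 ?Ew2.
  + split=> //.
    * by rewrite segS eqxx -S1; congr rcons; apply: eq_seg => j lt_j; case: eqP => //; lia.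
    * by rewrite -S2; apply: eq_seg => j lt_j; case: eqP => //; lia.
    * by move=> j lt_j; case: eqP => [|_]; [lia | apply: Ej].
  + split=> //.
    * by rewrite -S1; apply: eq_seg => j lt_j; case: eqP => //; lia.
    * by rewrite segS eqxx -S2; congr rcons; apply: eq_seg => j lt_j; case: eqP => //; lia.
    * by move=> j lt_j; case: eqP => [|_]; [lia | apply: Ej].
  + by [].
- move=> s1 [fi fq] [E14 _ _ _ _]; have := fi 12 isT.
  by rewrite /s0 /update /= => E12; rewrite E14 E12 En addn1 ltnn.
- by rewrite /=; lia.
by move=> s1 _ [_ [E16 E17] S1 S2 Ej].
Qed.
End Select.

(* Arguments in cells 11-13 (offset, length, rank), result in rational cell 11.
   Arrays 23-25, of height cell 22, are the stack that protects the arguments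
   across the recursive call on the medians; the other two calls are tail calls. *)
Definition select :=
  If (ILe i[12] #4)
    ((26 :=i i[11] ;; 27 :=i i[12] ;; 28 :=i i[13]) ;;
     Call 3 ;;
     11 :=q q[12])
    (medians ;;
     (ISet 23 i[22] i[11] ;; ISet 24 i[22] i[12] ;; ISet 25 i[22] i[13] ;;
      22 :=i i[22] +i #1 ;;
      11 :=i i[11] +i i[12] ;; 12 :=i i[14] ;; 13 :=i i[29]) ;;
     Call 2 ;;
     (22 :=i i[22] -i #1 ;;
      11 :=i IGet 23 i[22] ;; 12 :=i IGet 24 i[22] ;; 13 :=i IGet 25 i[22]) ;;
     pivot_partition ;;
     If (ILt i[13] i[16])
       ((11 :=i i[11] +i i[12] ;; 12 :=i i[16]) ;; Call 2)
       (If (ILe (i[12] -i i[17]) i[13])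
          ((13 :=i i[13] -i (i[12] -i i[17]) ;;
            11 :=i i[11] +i #2 *i i[12] ;; 12 :=i i[17]) ;; Call 2)
          Skip)).

Definition select_iregs : pred nat :=
  among [:: 11; 12; 13; 14; 15; 16; 17; 18; 19; 20; 21; 22; 23; 24; 25; 26; 27;
            28; 29].
Definition select_qregs : pred nat := among [:: 10; 11; 12; 13; 14].

(** Only the entries below height [d] belong to pending calls; a callee may overwrite everything
    from [d] upwards. *)
Definition same_stack d s s' :=
  imem s' 22 0 = imem s 22 0 /\
  forall a e, a \in [:: 23; 24; 25] -> e < d -> imem s' a e = imem s a e.

(** The value [w] must lie below [v]: otherwise all of the more than [k] entries below [v] would
    also lie below or at [v <= w], too many for rank [k]. Discarding the entries from [v] upwards
    then changes no relevant count. *)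
Lemma has_rank_lt xs k v w :
  k < count (fun x => x < v)%R xs ->
  has_rank (filter (fun x => x < v)%R xs) k w -> has_rank xs k w.
Proof.
rewrite /has_rank !count_filter => lt_k /andP[le1 lt2].
have lt_wv : (w < v)%R.
  rewrite ltNge; apply/negP => le_vw; move: le1; rewrite leqNgt.
  suff -> : k < count (predI (fun x => x < w)%R (fun x => x < v)%R) xs by [].
  apply: leq_trans lt_k _; apply: sub_count => x /= lt_x.
  by rewrite lt_x (lt_le_trans lt_x).
apply/andP; split.
  apply: leq_trans le1; apply: sub_count => x /= lt_x.
  by rewrite lt_x (lt_trans lt_x).
by apply: leq_trans lt2 _; apply: sub_count => x /= /andP[].
Qed.

Lemma has_rank_gt xs k v w :
  count (fun x => x <= v)%R xs <= k ->
  has_rank (filter (fun x => v < x)%R xs) (k - count (fun x => x <= v)%R xs) w ->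
  has_rank xs k w.
Proof.
rewrite /has_rank !count_filter => le_k /andP[le1 lt2].
have split_le (p : pred rat) : count p xs =
    count (predI p (fun x => x <= v)%R) xs + count (predI p (fun x => v < x)%R) xs.
  rewrite -size_filter -(count_predC (fun x => x <= v)%R) !count_filter.
  by congr (_ + _); apply: eq_count => x /=; rewrite ?ltNge andbC.
have lt_vw : (v < w)%R.
  rewrite ltNge; apply/negP => le_wv; move: lt2.
  suff -> : count (predI (fun x => x <= w)%R (fun x => v < x)%R) xs = 0 by [].
  apply/eqP; rewrite -leqn0 leqNgt -has_count.
  apply/hasPn => x _ /=; case: (leP x w) => //= le_xw.
  by rewrite -leNgt (le_trans le_xw).
rewrite (split_le (fun x => x < w)%R) (split_le (fun x => x <= w)%R).
have le_w : count (predI (fun x => x < w)%R (fun x => x <= v)%R) xs <=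
    count (fun x => x <= v)%R xs by apply: sub_count => x /= /andP[].
have eq_w : count (predI (fun x => x <= w)%R (fun x => x <= v)%R) xs =
    count (fun x => x <= v)%R xs.
  apply: eq_count => x /=; case: (leP x v) => [le_x|]; rewrite ?andbT ?andbF //.
  by rewrite (le_trans le_x) // ltW.
rewrite eq_w; apply/andP; split.
  by apply: leq_trans (leq_add le_w le1) _; rewrite subnKC.
by rewrite -[k in k < _](subnKC le_k) ltn_add2l.
Qed.

(* Half of the group medians lie on either side of the pivot, and each brings two
   more elements of its group to that side.  The remaining [n / 20] pays for the
   linear work outside the recursive calls. *)
Lemma pivot_balance f g b n v :
  4 < n ->
  (forall i, i < n %/ 5 -> has_rank (seg f (b + 5 * i) 5) 2 (g i)) ->
  has_rank (mkseq g (n %/ 5)) (n %/ 5)./2 v ->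
  let xs := seg f b n in
  20 * (n %/ 5 + count (fun x => x < v)%R xs) <= 19 * n /\
  20 * (n %/ 5 + count (fun x => v < x)%R xs) <= 19 * n.
Proof.
move=> lt_n rk_g /andP[le1 lt2] xs; set m := n %/ 5 in rk_g le1 lt2 *.
have le_m : 5 * m <= n by have := leq_trunc_div n 5; rewrite /m; lia.
have lt_m : n < 5 * m + 5 by have := ltn_ceil n (isT : 0 < 5); rewrite /m; lia.
have half_m : m = odd m + m./2 * 2 by rewrite muln2 odd_double_half.
have sz : size xs = n by rewrite size_seg.
have ge : 3 * count (fun x => v <= x)%R (mkseq g m) <= count (fun x => v <= x)%R xs.
  apply: group_count => // i lt_i le_v.
  have /andP[rk _] := rk_g i lt_i.
  apply: leq_trans (_ : _ <= count (fun x => g i <= x)%R (seg f (b + 5 * i) 5)) _.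
    by rewrite count_ge size_seg; lia.
  by apply: sub_count => x /=; apply: le_trans.
have le : 3 * count (fun x => x <= v)%R (mkseq g m) <= count (fun x => x <= v)%R xs.
  apply: group_count => // i lt_i le_v.
  have /andP[_ rk] := rk_g i lt_i; apply: leq_trans rk _.
  by apply: sub_count => x /= /le_trans; apply.
have odd1 : odd m <= 1 by case: (odd m).
rewrite count_gt sz; move: ge; rewrite !count_ge sz size_mkseq.
have := count_size (fun x => x < v)%R xs; rewrite sz.
have := count_size (fun x => x <= v)%R xs; rewrite sz.
have := count_size (fun x => x < v)%R (mkseq g m); rewrite size_mkseq.
move: le le1 lt2; lia.
Qed.

Section Select.
Variable P : program.
Hypothesis P2 : nth Skip P 2 = select.
Hypothesis P3 : nth Skip P 3 = small_select.

Definition select_spec s b n k s' :=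
  [/\ has_rank (seg (qmem s 10) b n) k (qmem s' 11 0),
      forall j, j < b -> qmem s' 10 j = qmem s 10 j
    & same_stack (imem s 22 0) s s'].

Lemma select_writes j : j \in [:: 2; 3] ->
  writes_in (among [:: 2; 3]) select_iregs select_qregs (nth Skip P j).
Proof. by rewrite !inE => /orP[/eqP ->|/eqP ->]; rewrite ?P2 ?P3. Qed.

(** The factor 20 is the inverse of the gap in [pivot_balance]: the two recursive calls together
    have at most [19 * n / 20] entries, so they cost at most [800 * 19 * n]. The remaining [800 * n]
    covers the medians ([440 * n]), the partition ([80 * n]) and the fixed overhead, as [n] is at
    least 5 in the recursive case. *)
Lemma select_runs n s b k :
  imem s 11 0 = b -> imem s 12 0 = n -> imem s 13 0 = k -> k < n ->
  runs P select s (800 * 20 * n) (select_spec s b n k).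
Proof.
elim/ltn_ind: n s b k => n IH s b k Eb En Ek lt_k.
apply: (@runs_if _ _ _ _ _ (800 * 20 * n - 4)); last by rewrite /=; lia.
  rewrite /= En => le_n.
  apply: (@runs_seq _ _ _ _ 12 (800 * 20 * n - 16)); last lia.
  apply: runs_straight => //; step; set s1 := State _ _.
  apply: (@runs_seq _ _ _ _ (11 + n * (100 + n * 60)) 4); last nia.
  apply: (@runs_call _ _ _ (10 + n * (100 + n * 60))); last lia.
  rewrite P3.
  have r3 := @small_select_runs P s1 b n k Eb En Ek lt_k.
  have {r3} r3 := runs_frame (c := small_select) (calls := no_calls)
    (wi := among [:: 18; 19; 20; 21]) (wq := among [:: 12; 14])
    (@no_callsP P _ _) isT r3.
  apply: runs_weaken r3 (leqnn _) _ => s2 [rk [fi fq]].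
  apply: runs_straight => //; step; split=> //=.
  + by move=> j _; rewrite (fq 10 isT).
  + split; first by rewrite /= (fi 22 isT).
    by move=> a e; rewrite !inE => /or3P[] /eqP -> _; rewrite /= fi.
rewrite /= En -ltnNge => gt_n.
apply: (@runs_seq _ _ _ _ (440 * n + 40) (778 * 20 * n - 44)); last lia.
have := runs_frame (c := medians) (calls := pred1 3)
    (wi := among [:: 14; 15; 18; 19; 20; 21; 26; 27; 28; 29]) (wq := among [:: 10; 12; 14])
    _ isT (medians_runs P3 Eb En).
have w3 j : pred1 3 j -> writes_in (pred1 3) (among [:: 14; 15; 18; 19; 20; 21; 26; 27; 28; 29])
    (among [:: 10; 12; 14]) (nth Skip P j) by move=> /eqP ->; rewrite P3.
move=> /(_ w3) {w3} r; apply: runs_weaken r (leqnn _) _.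
move=> s1 [[E14 E29 rk_g keep1] [fi1 fq1]].
have E11 : imem s1 11 0 = b by rewrite fi1.
have E12 : imem s1 12 0 = n by rewrite fi1.
have E13 : imem s1 13 0 = k by rewrite fi1.
have E22 : imem s1 22 0 = imem s 22 0 by rewrite fi1.
set m := n %/ 5 in E14 E29 rk_g; set d := imem s 22 0 in E22.
have m_gt0 : 0 < m by rewrite divn_gt0 //; lia.
have lt_m : 5 * m <= n by have := leq_trunc_div n 5; rewrite /m; lia.
apply: (@runs_seq _ _ _ _ 40 (778 * 20 * n - 84)); last lia.
apply: runs_straight => //; step.
rewrite E11 E12 E13 E14 E29 E22.
set s2 := State _ _.
apply: (@runs_seq _ _ _ _ (800 * 20 * m).+1 (778 * 20 * n - 800 * 20 * m - 85)); last lia.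
apply: (@runs_call _ _ _ (800 * 20 * m)); last lia.
rewrite P2.
have lt_half : m./2 < m by rewrite -divn2; apply: ltn_Pdiv.
have lt_mn : m < n by lia.
have := runs_frame select_writes (c := select) isT
  (IH m lt_mn s2 (b + n) m./2 erefl erefl erefl lt_half).
move=> r; apply: runs_weaken r (leqnn _) _.
move=> s3 [[rk keep2 [depth2 stack2]] fr2].
have {depth2} depth2 : imem s3 22 0 = d + 1 by rewrite depth2.
(* The saved arguments sit at height [d], while the call starts at height [d + 1] and preserves
   everything below it. *)
have stk a : a \in [:: 23; 24; 25] -> imem s3 a d = imem s2 a d.
  by move=> Ha; rewrite stack2 // /s2 /= addn1.
apply: (@runs_seq _ _ _ _ 30 (778 * 20 * n - 800 * 20 * m - 115)); last lia.
apply: runs_straight => //; step.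
rewrite depth2 addnK !stk // /s2 /= eqxx /=.
set s4 := State _ _.
apply: (@runs_seq _ _ _ _ (80 * n + 40) (774 * 20 * n - 800 * 20 * m - 155)); last lia.
have r4 := @pivot_partition_runs P s4 b n (qmem s3 11 0) erefl erefl erefl.
have {r4} r4 := runs_frame (c := pivot_partition) (calls := no_calls)
  (wi := among [:: 14; 16; 17]) (wq := among [:: 10; 13]) (@no_callsP P _ _) isT r4.
apply: runs_weaken r4 (leqnn _) _ => s5 [].
set v := qmem s3 11 0.
have keep4 j : j < b + n -> qmem s4 10 j = qmem s 10 j.
  by move=> lt_j; rewrite /s4 /= keep2 // keep1.
have -> : seg (qmem s4 10) b n = seg (qmem s 10) b n.
  by apply: eq_seg => j /andP[_]; apply: keep4.
set xs := seg (qmem s 10) b n.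
move=> [/= E16 E17 S1 S2 keep5] [fi5 fq5].
have F11 : imem s5 11 0 = b by rewrite fi5.
have F12 : imem s5 12 0 = n by rewrite fi5.
have F13 : imem s5 13 0 = k by rewrite fi5.
have F22 : imem s5 22 0 = d by rewrite fi5.
have keep j : j < b + n -> qmem s5 10 j = qmem s 10 j.
  by move=> lt_j; rewrite keep5 // keep4.
have stk5 a e : a \in [:: 23; 24; 25] -> e < d -> imem s5 a e = imem s a e.
  rewrite !inE => Ha lt_e; have ne_e : e == d = false by apply/eqP; lia.
  case/or3P: Ha => /eqP ->; rewrite fi5 //= stack2 //=; try lia;
    by rewrite ne_e /= fi1.
have Fv : qmem s5 11 0 = v by rewrite fq5.
have [] := @pivot_balance (qmem s 10) (fun g => qmem s1 10 (b + n + g)) b n v gt_n rk_g rk.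
rewrite -/xs -/m => bal1 bal2.
have sz_xs : size xs = n by rewrite size_seg.
apply: (@runs_if _ _ _ _ _ (774 * 20 * n - 800 * 20 * m - 170)); last by rewrite /=; lia.
  rewrite /= F13 E16 addn1 => lt_kL.
  apply: (@runs_seq _ _ _ _ 20 (774 * 20 * n - 800 * 20 * m - 190)); last lia.
  apply: runs_straight => //; step; rewrite F11 F12 E16.
  set L := count _ _; set s6 := State _ _.
  apply: (@runs_call _ _ _ (800 * 20 * L)); last by rewrite -/L in bal1; lia.
  rewrite P2.
  have lt_L : L < n by rewrite -/L in bal1; lia.
  have F6 : imem s6 13 0 = k by [].
  apply: runs_weaken (IH L lt_L s6 (b + n) k erefl erefl F6 lt_kL) (leqnn _) _.
  rewrite /s6 /= => s7 [rk7 keep7 [depth7 stack7]].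
  split.
  - apply: (has_rank_lt (v := v) lt_kL); rewrite -S1 E16; exact: rk7.
  - by move=> j lt_j; rewrite keep7 /= ?keep //; lia.
  - split; first by rewrite depth7.
    move=> a e Ha lt_e; rewrite stack7 //=; last by rewrite F22.
    by move: (Ha); rewrite !inE => /or3P[] /eqP Ea; rewrite Ea /= stk5 // -Ea.
rewrite /= F13 E16 addn1 -leqNgt => ge_kL.
apply: (@runs_if _ _ _ _ _ (774 * 20 * n - 800 * 20 * m - 190)); last by rewrite /=; lia.
  rewrite /= F12 F13 E17 count_gt sz_xs.
  have le_cnt := count_size (fun x => x <= v)%R xs; rewrite sz_xs in le_cnt.
  rewrite subKn // => ge_kE.
  apply: (@runs_seq _ _ _ _ 40 (774 * 20 * n - 800 * 20 * m - 230)); last lia.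
  apply: runs_straight => //; step; rewrite F11 F12 F13 E17 count_gt sz_xs subKn //.
  rewrite count_gt sz_xs in bal2.
  set E := count _ _ in bal2 le_cnt ge_kE *; set s6 := State _ _.
  apply: (@runs_call _ _ _ (800 * 20 * (n - E))); last by lia.
  rewrite P2.
  have lt_E : n - E < n by lia.
  have lt_k6 : k - E < n - E by lia.
  apply: runs_weaken (IH _ lt_E s6 (b + 2 * n) (k - E) erefl erefl erefl lt_k6) (leqnn _) _.
  rewrite /s6 /= => s7 [rk7 keep7 [depth7 stack7]].
  split.
  - apply: (has_rank_gt (v := v) ge_kE); rewrite -S2 E17 count_gt sz_xs; exact: rk7.
  - by move=> j lt_j; rewrite keep7 /= ?keep //; lia.
  - split; first by rewrite depth7.
    move=> a e Ha lt_e; rewrite stack7 //=; last by rewrite F22.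
    by move: (Ha); rewrite !inE => /or3P[] /eqP Ea; rewrite Ea /= stk5 // -Ea.
rewrite /= F12 F13 E17 count_gt sz_xs.
have le_cnt := count_size (fun x => x <= v)%R xs; rewrite sz_xs in le_cnt.
rewrite subKn // -ltnNge => lt_kE.
apply: runs_straight => //=; first by lia.
split.
- by rewrite Fv /has_rank ge_kL lt_kE.
- by move=> j lt_j; rewrite keep //; lia.
- by split=> //; rewrite F22.
Qed.
End Select.

(** * Cheapest [p] items *)

Definition lin_value (A B : nat -> rat) n (x y : nat -> nat) : rat :=
  (\sum_(j < n) (A j * (x j)%:R + B j * (y j)%:R))%R.

(** Subtract [tau] for every item taken. Both solutions take [p] items, so the comparison is
    unaffected, and it can now be made item by item: [m - tau] is collected exactly where it is
    negative, and ties contribute 0 either way. *)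
Lemma threshold_optimal n (A B : nat -> rat) (tau : rat) p (x y x' y' : nat -> nat) :
  (forall j, j < n ->
    let m := Num.min (A j) (B j) in
    [/\ (m < tau)%R -> x j + y j = 1, (tau < m)%R -> x j + y j = 0
      & (A j * (x j)%:R + B j * (y j)%:R = m * (x j + y j)%:R)%R]) ->
  \sum_(j < n) (x j + y j) = p -> \sum_(j < n) (x' j + y' j) = p ->
  (forall j, j < n -> x' j + y' j <= 1) ->
  (lin_value A B n x y <= lin_value A B n x' y')%R.
Proof.
move=> thr sum_p sum_p' le1.
have shift (u w : nat -> nat) : \sum_(j < n) (u j + w j) = p ->
    lin_value A B n u w = (\sum_(j < n) (A j * (u j)%:R + B j * (w j)%:R
                           - tau * (u j + w j)%:R) + tau * p%:R)%R.
  move=> <-; rewrite natr_sum mulr_sumr -big_split /=.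
  by apply: eq_bigr => j _; rewrite subrK.
rewrite (shift _ _ sum_p) (shift _ _ sum_p') lerD2r; apply: ler_sum => j _.
have := thr j (ltn_ord j); rewrite /=.
set m := Num.min _ _ => -[lt_m gt_m ->].
have le_A : (m <= A j)%R by rewrite ge_min lexx.
have le_B : (m <= B j)%R by rewrite ge_min lexx orbT.
apply: (@le_trans _ _ ((m - tau) * (x' j + y' j)%:R)%R).
  rewrite -mulrBl; have := le1 j (ltn_ord j).
  case: (ltgtP m tau) => H.
  - rewrite (lt_m H); case: (x' j + y' j) => [_|[|//] _]; rewrite ?mulr0 ?mulr1 ?lexx //.
    by rewrite ltW // subr_lt0.
  - by rewrite (gt_m H) mulr0 => _; rewrite mulr_ge0 ?ler0n // subr_ge0 ltW.
  - by rewrite H subrr !mul0r.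
rewrite mulrBl lerB // natrD mulrDr.
by apply: lerD; apply: ler_wpM2r; rewrite ?ler0n.
Qed.

(* Rational cell 5 holds the multiplier of the deviations, and [i[10]] the current
   item. *)
Definition nominal_plus := QAdd (QGet 1 i[10]) (QMul q[5] (QGet 2 i[10])).

Definition fill_keys :=
  10 :=i #0 ;;
  While (ILt i[10] (IGet 0 #0))
    (13 :=q QGet 0 i[10] ;;
     If (QLe q[13] nominal_plus) Skip (13 :=q nominal_plus) ;;
     QSet 15 i[10] q[13] ;; QSet 10 i[10] q[13] ;;
     10 :=i i[10] +i #1).

Definition count_ties :=
  (10 :=i #0 ;; 30 :=i IGet 0 #1) ;;
  While (ILt i[10] (IGet 0 #0))
    (If (QLe q[11] (QGet 15 i[10])) Skip (30 :=i i[30] -i #1) ;;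
     10 :=i i[10] +i #1).

(* Cell 30 is the number of items of threshold cost still to be taken. *)
Definition take_items :=
  (10 :=i #0 ;; 4 :=q QMul (QSub (QNum 1%R) q[5]) q[3]) ;;
  While (ILt i[10] (IGet 0 #0))
    (31 :=i #1 ;;
     If (QLe q[11] (QGet 15 i[10]))
       (If (QLe (QGet 15 i[10]) q[11])
          (If (ILe #1 i[30]) (30 :=i i[30] -i #1) (31 :=i #0))
          (31 :=i #0))
       Skip ;;
     If (ILe #1 i[31])
       (4 :=q QAdd q[4] (QGet 15 i[10]) ;;
        If (QLe (QGet 0 i[10]) nominal_plus)
          (ISet 1 i[10] #1 ;; ISet 2 i[10] #0)
          (ISet 1 i[10] #0 ;; ISet 2 i[10] #1))
       (ISet 1 i[10] #0 ;; ISet 2 i[10] #0) ;;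
     10 :=i i[10] +i #1).

Definition solver_p :=
  fill_keys ;;
  (11 :=i #0 ;; 12 :=i IGet 0 #0 ;; 13 :=i IGet 0 #1 -i #1) ;;
  Call 2 ;;
  count_ties ;;
  take_items.

Section Solver.
Variable P : program.
Hypothesis P2 : nth Skip P 2 = select.
Hypothesis P3 : nth Skip P 3 = small_select.
Variables (A B : nat -> rat) (n p : nat).

Definition has_costs s :=
  (forall j, qmem s 0 j = A j) /\
  (forall j, (qmem s 1 j + qmem s 5 0 * qmem s 2 j)%R = B j).

Definition key j : rat := Num.min (A j) (B j).

Lemma agree_costs wi wq s s' : agree wi wq s s' -> {in [:: 0; 1; 2; 5], forall a, ~~ wq a} ->
  has_costs s -> has_costs s'.
Proof.
move=> [_ fq] nw [H0 H1]; split=> j; first by rewrite fq ?nw.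
by rewrite !fq ?nw.
Qed.

Lemma fill_keys_runs s :
  imem s 0 0 = n -> has_costs s ->
  runs P fill_keys s (70 * n + 20) (fun s' =>
    forall j, j < n -> qmem s' 15 j = key j /\ qmem s' 10 j = key j).
Proof.
move=> En costs.
apply: (@runs_seq _ _ _ _ 3 (70 * n + 17)); last lia.
apply: runs_straight => //; step; set s0 := State _ _.
pose Inv i (s' : state) := imem s' 10 0 = i /\
  forall j, j < i -> qmem s' 15 j = key j /\ qmem s' 10 j = key j.
apply: (@runs_for_frame _ no_calls (among [:: 10]) (among [:: 10; 13; 15]) Inv n 60) => //.
- move=> i s1 lt_i fr [Ei keys].
  have [C0 C1] : has_costs s1 by apply: agree_costs fr _ costs => a; rewrite !inE => /or4P[] /eqP ->.
  have En1 : imem s1 0 0 = n by rewrite fr.1.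
  split; first by rewrite /= Ei En1 addn1.
  apply: runs_straight => //; rewrite /Inv; step.
  rewrite Ei C0 C1 addn1; case: ifP => le_AB; step; (split=> // j; rewrite ltnS leq_eqVlt;
    case: (eqVneq j i) => [-> _|ne /= lt_j]; last by apply: keys).
    by rewrite /key min_l.
  by rewrite /key min_r // ltW // ltNge le_AB.
- move=> s1 fr [Ei _]; have En1 : imem s1 0 0 = n by rewrite fr.1.
  by rewrite /= Ei En1 addn1 ltnn.
- by rewrite /=; lia.
by move=> s1 _ [_ keys].
Qed.

Lemma count_ties_runs s :
  imem s 0 0 = n -> imem s 0 1 = p ->
  (forall j, j < n -> qmem s 15 j = key j) ->
  runs P count_ties s (70 * n + 20) (fun s' =>
    imem s' 30 0 = p - count (fun x => x < qmem s 11 0)%R (seg key 0 n)).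
Proof.
move=> En Ep keys.
apply: (@runs_seq _ _ _ _ 8 (70 * n + 10)); last lia.
apply: runs_straight => //; step; set s0 := State _ _.
pose Inv i (s' : state) := imem s' 10 0 = i /\
  imem s' 30 0 = p - count (fun x => x < qmem s 11 0)%R (seg key 0 i).
apply: (@runs_for_frame _ no_calls (among [:: 10; 30]) xpred0 Inv n 60) => //.
- by rewrite /Inv /s0 /= Ep subn0.
- move=> i s1 lt_i fr [Ei E30].
  have En1 : imem s1 0 0 = n by rewrite fr.1.
  split; first by rewrite /= Ei En1 addn1.
  apply: runs_straight => //; rewrite /Inv segS count_rcons; step.
  rewrite Ei !fr.2 //= keys // addn1.
  case: leP => _; step; rewrite E30 ?addn0 ?subnDA; split=> //.
- move=> s1 fr [Ei _]; have En1 : imem s1 0 0 = n by rewrite fr.1.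
  by rewrite /= Ei En1 addn1 ltnn.
- by rewrite /=; lia.
by move=> s1 _ [].
Qed.

(** Nothing prescribes which items of cost [tau] are taken, because any choice among them is optimal
    as long as the total is [p]. *)
Definition taken (tau : rat) j (x y : nat -> nat) :=
  [/\ x j + y j <= 1, (key j < tau)%R -> x j + y j = 1,
      (tau < key j)%R -> x j + y j = 0
    & (A j * (x j)%:R + B j * (y j)%:R = key j * (x j + y j)%:R)%R].

(** The truncated difference is the part of the quota that the ties could not fill. Keeping it in
    the equation makes the loop analysis independent of the choice of [tau] and [rem]. *)
Lemma take_items_runs s :
  imem s 0 0 = n -> has_costs s ->
  (forall j, j < n -> qmem s 15 j = key j) ->
  let tau := qmem s 11 0 in let rem := imem s 30 0 in
  let xs := seg key 0 n in
  runs P take_items s (140 * n + 30) (fun s' =>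
    [/\ forall j, j < n -> taken tau j (imem s' 1) (imem s' 2),
        \sum_(j < n) (imem s' 1 j + imem s' 2 j)
          + (rem - count (fun x => x == tau) xs)
          = count (fun x => x < tau)%R xs + rem
      & (qmem s' 4 0 = lin_value A B n (imem s' 1) (imem s' 2)
                       + (1 - qmem s 5 0) * qmem s 3 0)%R]).
Proof.
move=> En costs keys tau rem xs.
apply: (@runs_seq _ _ _ _ 12 (140 * n + 18)); last lia.
apply: runs_straight => //; step; set s0 := State _ _.
pose Inv i (s' : state) := [/\ imem s' 10 0 = i,
  forall j, j < i -> taken tau j (imem s' 1) (imem s' 2),
  imem s' 30 0 = rem - count (fun x => x == tau) (seg key 0 i),
  \sum_(j < i) (imem s' 1 j + imem s' 2 j) + imem s' 30 0
    = count (fun x => x < tau)%R (seg key 0 i) + rem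
  & (qmem s' 4 0 = lin_value A B i (imem s' 1) (imem s' 2)
                   + (1 - qmem s 5 0) * qmem s 3 0)%R].
apply: (@runs_for_frame _ no_calls (among [:: 1; 2; 10; 30; 31]) (among [:: 4]) Inv n 120) => //.
- by split=> //=; rewrite ?subn0 ?big_ord0 // /lin_value big_ord0 add0r.
- move=> i s1 lt_i fr [Ei tk Erem Esum Eval].
  have [C0 C1] : has_costs s1 by apply: agree_costs fr _ costs => a; rewrite !inE => /or4P[] /eqP ->.
  have En1 : imem s1 0 0 = n by rewrite fr.1.
  split; first by rewrite /= Ei En1 addn1.
  apply: runs_straight => //; step.
  have Ekey : qmem s1 15 i = key i by rewrite fr.2 //= keys.
  have Etau : qmem s1 11 0 = tau by rewrite fr.2.
  rewrite Ei Ekey Etau C0 C1.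
  (* All branches write one bit to each output vector and update the quota; the invariant is
     restored here once for all of them. *)
  have out s2 (bx by_ : nat) (r : nat) :
      imem s2 10 0 = i.+1 -> imem s2 30 0 = r ->
      imem s2 1 = (fun j => if j == i then bx else imem s1 1 j) ->
      imem s2 2 = (fun j => if j == i then by_ else imem s1 2 j) ->
      qmem s2 4 0 = (qmem s1 4 0 + key i * (bx + by_)%:R)%R ->
      bx + by_ <= 1 -> ((key i < tau)%R -> bx + by_ = 1) ->
      ((tau < key i)%R -> bx + by_ = 0) ->
      (A i * bx%:R + B i * by_%:R = key i * (bx + by_)%:R)%R ->
      r = imem s1 30 0 - (key i == tau) ->
      bx + by_ + r = imem s1 30 0 + (key i < tau)%R ->
      Inv i.+1 s2.
    move=> E10 E30 Ex Ey E4 le1 k1 k2 k3 Er Es.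
    have old j : j < i -> imem s2 1 j = imem s1 1 j /\ imem s2 2 j = imem s1 2 j.
      by move=> lt_j; rewrite Ex Ey ltn_eqF.
    have Exi : imem s2 1 i = bx by rewrite Ex eqxx.
    have Eyi : imem s2 2 i = by_ by rewrite Ey eqxx.
    split=> //.
    - move=> j; rewrite ltnS leq_eqVlt /taken => /orP[/eqP->|lt_j].
        by rewrite Exi Eyi.
      by have [-> ->] := old j lt_j; apply: tk.
    - by rewrite segS count_rcons E30 Er Erem subnDA.
    - rewrite segS count_rcons big_ord_recr /= Exi Eyi E30.
      rewrite -addnA Es -addnAC -Esum addnCA addnC [RHS]addnAC; congr (_ + _ + _).
      by apply: eq_bigr => j _; have [-> ->] := old j (ltn_ord j).
    - rewrite E4 Eval /lin_value big_ord_recr /= Exi Eyi k3 -addrA [RHS]addrAC addrA.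
      congr (_ + _ + _)%R.
      by apply: eq_bigr => j _; have [-> ->] := old j (ltn_ord j).
  have key_x : (A i <= B i)%R -> (A i * 1%:R + B i * 0%:R = key i * (1 + 0)%:R)%R.
    by move=> le_AB; rewrite /key min_l // mulr0 addr0.
  have key_y : (A i <= B i)%R = false -> (A i * 0%:R + B i * 1%:R = key i * (0 + 1)%:R)%R.
    by move=> gt_AB; rewrite /key min_r ?mulr0 ?add0r // ltW // ltNge gt_AB.
  rewrite addn1; move: out; case: (ltgtP tau (key i)) => Hk out.
  - by apply: (out _ 0 0 (imem s1 30 0)); rewrite //= ?mulr0 ?addr0 ?subn0 ?addn0.
  - case: ifP => le_AB.
      by apply: (out _ 1 0 (imem s1 30 0)); rewrite /= ?key_x //= ?mulr1 ?subn0 1?addnC.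
    by apply: (out _ 0 1 (imem s1 30 0)); rewrite /= ?key_y //= ?mulr1 ?subn0 1?addnC.
  - case: ifP => [rem_gt0|rem_eq0]; last first.
      apply: (out _ 0 0 (imem s1 30 0)); rewrite //= ?mulr0 ?addr0 ?addn0 //.
      by move: rem_eq0; case: (imem s1 30 0).
    case: ifP => le_AB.
      by apply: (out _ 1 0 (imem s1 30 0 - 1)); rewrite /= ?key_x //= ?mulr1 ?addn0 ?subnKC.
    by apply: (out _ 0 1 (imem s1 30 0 - 1)); rewrite /= ?key_y //= ?mulr1 ?addn0 ?subnKC.
- move=> s1 fr [Ei _ _ _ _]; have En1 : imem s1 0 0 = n by rewrite fr.1.
  by rewrite /= Ei En1 addn1 ltnn.
- by rewrite /=; lia.
by move=> s1 _ [_ tk Erem Esum Eval]; split=> //; rewrite -Erem.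
Qed.
Lemma count_le_lt_eq (tau : rat) xs :
  count (fun x => x <= tau)%R xs =
  count (fun x => x < tau)%R xs + count (fun x => x == tau) xs.
Proof.
rewrite -count_predUI [X in _ = _ + X](_ : _ = 0) ?addn0.
  by apply: eq_count => x /=; rewrite le_eqVlt orbC.
apply/eqP; rewrite -leqn0 leqNgt -has_count; apply/hasPn => x _ /=.
by case: ltgtP.
Qed.

Lemma solver_p_runs s :
  imem s 0 0 = n -> imem s 0 1 = p -> has_costs s -> 0 < p <= n ->
  runs P solver_p s (830 * 20 * n) (fun s' =>
    [/\ forall j, j < n -> imem s' 1 j + imem s' 2 j <= 1,
        \sum_(j < n) (imem s' 1 j + imem s' 2 j) = p,
        (qmem s' 4 0 = lin_value A B n (imem s' 1) (imem s' 2)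
                       + (1 - qmem s 5 0) * qmem s 3 0)%R
      & forall x y : nat -> nat, (forall j, j < n -> x j + y j <= 1) ->
          \sum_(j < n) (x j + y j) = p ->
          (lin_value A B n (imem s' 1) (imem s' 2) <= lin_value A B n x y)%R]).
Proof.
move=> En Ep costs /andP[p_gt0 le_pn].
have costsP a : a \in [:: 0; 1; 2; 5] -> [\/ a = 0, a = 1, a = 2 | a = 5].
  by rewrite !inE => /or4P[] /eqP; [constructor 1|constructor 2|constructor 3|constructor 4].
apply: (@runs_seq _ _ _ _ (70 * n + 20) (825 * 20 * n - 20)); last lia.
have r1 := runs_frame (c := fill_keys) (calls := no_calls)
  (wi := among [:: 10]) (wq := among [:: 10; 13; 15]) (@no_callsP P _ _) isT
  (fill_keys_runs En costs).
apply: runs_weaken r1 (leqnn _) _ => s1 [keys fr1].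
have costs1 : has_costs s1 by apply: agree_costs fr1 _ costs => a /costsP[] ->.
apply: (@runs_seq _ _ _ _ 20 (824 * 20 * n - 20)); last lia.
apply: runs_straight => //; step; rewrite !fr1.1 // En Ep; set s2 := State _ _.
apply: (@runs_seq _ _ _ _ (800 * 20 * n).+1 (24 * 20 * n - 21)); last lia.
apply: (@runs_call _ _ _ (800 * 20 * n)); last lia.
rewrite P2.
have lt_p : p - 1 < n by lia.
have r3 := runs_frame (c := select) (select_writes P2 P3) isT
  (select_runs P2 P3 (s := s2) (b := 0) (n := n) (k := p - 1) erefl erefl erefl lt_p).
apply: runs_weaken r3 (leqnn _) _ => s3 [[rk _ _] fr3].
have Eseg : seg (qmem s2 10) 0 n = seg key 0 n.
  by apply: eq_seg => j /= lt_j; rewrite /s2 /= (keys j _).2.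
rewrite Eseg in rk; set tau := qmem s3 11 0 in rk.
have En3 : imem s3 0 0 = n by rewrite fr3.1 // /s2 /= fr1.1.
have Ep3 : imem s3 0 1 = p by rewrite fr3.1 // /s2 /= fr1.1.
have costs3 : has_costs s3 by apply: agree_costs fr3 _ costs1 => a /costsP[] ->.
have keys3 j : j < n -> qmem s3 15 j = key j.
  by move=> lt_j; rewrite fr3.2 // /s2 /= (keys j lt_j).1.
apply: (@runs_seq _ _ _ _ (70 * n + 20) (140 * n + 30)); last lia.
have r4 := runs_frame (c := count_ties) (calls := no_calls)
  (wi := among [:: 10; 30]) (wq := xpred0) (@no_callsP P _ _) isT
  (count_ties_runs En3 Ep3 keys3).
apply: runs_weaken r4 (leqnn _) _ => s4 [Erem fr4].
have En4 : imem s4 0 0 = n by rewrite fr4.1.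
have costs4 : has_costs s4 by apply: agree_costs fr4 _ costs3.
have keys4 j : j < n -> qmem s4 15 j = key j by move=> lt_j; rewrite fr4.2 // keys3.
have Etau : qmem s4 11 0 = tau by rewrite fr4.2.
apply: runs_weaken (take_items_runs En4 costs4 keys4) (leqnn _) _ => s5.
rewrite Etau Erem => -[tk Esum ->].
have Ef : qmem s4 5 0 = qmem s 5 0 by rewrite fr4.2 // fr3.2 // /s2 /= fr1.2.
have Eg : qmem s4 3 0 = qmem s 3 0 by rewrite fr4.2 // fr3.2 // /s2 /= fr1.2.
(* Rank [p - 1] means that fewer than [p] costs lie below [tau] and at least [p] do not exceed it,
   so the ties suffice and the unfilled quota is 0. *)
have {}Esum : \sum_(j < n) (imem s5 1 j + imem s5 2 j) = p.
  move: rk; rewrite /has_rank count_le_lt_eq => /andP[rk1 rk2].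
  have le_L : count (fun x => x < tau)%R (seg key 0 n) <= p by lia.
  by move: Esum; rewrite subnKC // => <-; rewrite -/tau; lia.
split=> //; first by move=> j /tk[].
- by rewrite Ef Eg.
- move=> x y le1 sum_p; apply: (@threshold_optimal _ _ _ tau p) => //.
  by move=> j lt_j; have [_ H1 H2 H3] := tk j lt_j; split.
Qed.
End Solver.

(** * Dynamic programming over the overlap *)

(* Integer cells: 10 address of the current table entry, 11-14 its coordinates
   [i u v w] (number of items seen, items in [x] only, in [y] only, in both),
   15-17 the strides, 18 the best choice found so far (4 for none); array 20
   stores the choices.  Rational cells: 11 best value, 12 candidate; array 10 is
   the table. *)
Definition consider (t : test) (off : iexp) (cost : qexp) (c : nat) :=
  If t
    (12 :=q QAdd (QGet 10 (i[10] -i off)) cost ;;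
     If (ILe i[18] #3)
       (If (QLe q[11] q[12]) Skip (11 :=q q[12] ;; 18 :=i #c))
       (11 :=q q[12] ;; 18 :=i #c))
    Skip.

Definition item_x := QGet 0 (i[11] -i #1).
Definition item_y := QAdd (QGet 1 (i[11] -i #1)) (QMul q[5] (QGet 2 (i[11] -i #1))).

(** The coordinates are kept as an odometer running in step with the address, since they could not
    be recovered from it without integer division. *)
Definition advance :=
  10 :=i i[10] +i #1 ;; 14 :=i i[14] +i #1 ;;
  If (ILe i[14] (IGet 0 #1)) Skip
    (14 :=i #0 ;; 13 :=i i[13] +i #1 ;;
     If (ILe i[13] (IGet 0 #2)) Skip
       (13 :=i #0 ;; 12 :=i i[12] +i #1 ;;
        If (ILe i[12] (IGet 0 #2)) Skip
          (12 :=i #0 ;; 11 :=i i[11] +i #1))).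

Definition fill_table :=
  (10 :=i #0 ;; 11 :=i #0 ;; 12 :=i #0 ;; 13 :=i #0 ;; 14 :=i #0 ;;
   17 :=i IGet 0 #1 +i #1 ;;
   16 :=i (IGet 0 #2 +i #1) *i i[17] ;;
   15 :=i (IGet 0 #2 +i #1) *i i[16]) ;;
  While (ILe i[11] (IGet 0 #0))
    (If (ILe #1 i[11])
       (18 :=i #4 ;;
        consider (ILt (i[12] +i i[13] +i i[14]) i[11]) i[15] (QNum 0%R) 0 ;;
        consider (ILe #1 i[12]) (i[15] +i i[16]) item_x 1 ;;
        consider (ILe #1 i[13]) (i[15] +i i[17]) item_y 2 ;;
        consider (ILe #1 i[14]) (i[15] +i #1) (QAdd item_x item_y) 3 ;;
        (QSet 10 i[10] q[11] ;; ISet 20 i[10] i[18]))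
       (QSet 10 i[10] (QNum 0%R)) ;;
     advance).

Lemma digits_inj m a b a' b' : b < m -> b' < m ->
  a * m + b = a' * m + b' -> a = a' /\ b = b'.
Proof.
move=> lt_b lt_b' E; have m_gt0 : 0 < m by lia.
split.
  by have := congr1 (divn^~ m) E; rewrite /= !divnMDl // !divn_small // !addn0.
by have := congr1 (modn^~ m) E; rewrite /= !modnMDl !modn_small.
Qed.

Lemma digits_lt m a b bound : b < m -> a < bound -> a * m + b < bound * m.
Proof.
move=> lt_b lt_a; apply: leq_trans (_ : a.+1 * m <= _); last by rewrite leq_mul2r lt_a orbT.
by rewrite mulSn addnC ltn_add2r.
Qed.

(** * Addresses and Bellman equations of the table *)

Section Table.
Variables (A B : nat -> rat) (n p k : nat).

Definition code i u v w := ((i * k.+1 + u) * k.+1 + v) * p.+1 + w.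
Definition stride_v := p.+1.
Definition stride_u := k.+1 * stride_v.
Definition stride_i := k.+1 * stride_u.

Definition in_range u v w := [&& u <= k, v <= k & w <= p].

Lemma codeE i u v w : code i u v w = i * stride_i + u * stride_u + v * stride_v + w.
Proof. by rewrite /code /stride_i /stride_u /stride_v; lia. Qed.

Lemma code_inj i u v w i' u' v' w' : in_range u v w -> in_range u' v' w' ->
  code i u v w = code i' u' v' w' -> [/\ i = i', u = u', v = v' & w = w'].
Proof.
move=> /and3P[lu lv lw] /and3P[lu' lv' lw'].
move=> /(digits_inj (lw : w < p.+1) (lw' : w' < p.+1))[].
move=> /(digits_inj (lv : v < k.+1) (lv' : v' < k.+1))[].
by move=> /(digits_inj (lu : u < k.+1) (lu' : u' < k.+1))[].
Qed.

Lemma code_lt i u v w : in_range u v w -> code i u v w < i.+1 * stride_i.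
Proof.
move=> /and3P[lu lv lw]; rewrite /code /stride_i /stride_u /stride_v !mulnA.
by do 3!apply: digits_lt => //.
Qed.

(* The four ways to treat an item: 0 leaves it out, 1 puts it in [x] only, 2 in
   [y] only, 3 in both. *)
Definition choice_ok c i u v w :=
  match c with 0 => u + v + w <= i | 1 => 0 < u | 2 => 0 < v | _ => 0 < w end.

Definition choice_cost c i : rat :=
  match c with 0 => 0%R | 1 => A i | 2 => B i | _ => (A i + B i)%R end.

Definition choice_offset c :=
  match c with
  | 0 => stride_i | 1 => stride_i + stride_u
  | 2 => stride_i + stride_v | _ => stride_i + 1
  end.

(** The Bellman equation together with the choice that attains it. It mentions neighbouring entries
    only, so it can be checked as soon as the entry is written. *)
Definition cell_ok (D : nat -> rat) (ch : nat -> nat) i u v w :=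
  let e := code i.+1 u v w in
  [/\ ch e < 4, choice_ok (ch e) i u v w,
      (D e = D (e - choice_offset (ch e))%N + choice_cost (ch e) i)%R
    & forall c, c < 4 -> choice_ok c i u v w ->
        (D e <= D (e - choice_offset c)%N + choice_cost c i)%R].

(* Entries with [i < u + v + w] have no meaning and are never read through a valid
   choice. *)
Definition table_ok (D : nat -> rat) (ch : nat -> nat) bound :=
  (0 < bound -> D 0 = 0%R) /\
  forall i u v w, in_range u v w -> u + v + w <= i.+1 -> code i.+1 u v w < bound ->
    cell_ok D ch i u v w.

Lemma stride_gt0 : 0 < stride_i.
Proof. by rewrite /stride_i /stride_u /stride_v; lia. Qed.

Lemma table_ok_ext D ch D' ch' e :
  (forall j, j < e -> D' j = D j /\ ch' j = ch j) ->
  table_ok D ch e -> table_ok D' ch' e.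
Proof.
move=> ext [D0 cells]; split=> [e_gt0|i u v w rg le_i lt_e].
  by rewrite (ext 0 e_gt0).1 D0.
have [] := cells i u v w rg le_i lt_e; rewrite /cell_ok.
have [-> ->] := ext _ lt_e.
have E c : D' (code i.+1 u v w - choice_offset c) = D (code i.+1 u v w - choice_offset c).
  by apply: (ext _ _).1; lia.
move=> H1 H2 H3 H4; split=> //; first by rewrite E.
by move=> c lt_c ok_c; rewrite E; apply: H4.
Qed.

Lemma table_ok_next D ch D' ch' e :
  table_ok D ch e ->
  (forall j, j < e -> D' j = D j /\ ch' j = ch j) ->
  (e = 0 -> D' 0 = 0%R) ->
  (forall i u v w, in_range u v w -> u + v + w <= i.+1 -> code i.+1 u v w = e ->
    cell_ok D' ch' i u v w) ->
  table_ok D' ch' e.+1.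
Proof.
move=> tab ext D0 new; have [D0' cells] := table_ok_ext ext tab.
split=> [_|i u v w rg le_i]; first by case: (posnP e) => [/D0|/D0'].
by rewrite ltnS leq_eqVlt => /orP[/eqP|]; [apply: new | apply: cells].
Qed.

Section Consider.
Variables (P : program) (e i u v w : nat) (D : nat -> rat).

Let val c : rat := (D (e - choice_offset c)%N + choice_cost c i)%R.

Definition best_of c s :=
  (imem s 18 0 = 4 /\ forall c', c' < c -> ~~ choice_ok c' i u v w) \/
  [/\ imem s 18 0 < c, choice_ok (imem s 18 0) i u v w,
      qmem s 11 0 = val (imem s 18 0)
    & forall c', c' < c -> choice_ok c' i u v w -> (qmem s 11 0 <= val c')%R].

Lemma consider_runs t off cost c s :
  c < 4 ->
  teval s t = choice_ok c i u v w ->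
  qmem s 10 (imem s 10 0 - ieval s off) = D (e - choice_offset c) ->
  qeval s cost = choice_cost c i ->
  best_of c s ->
  runs P (consider t off cost c) s (max_cost (consider t off cost c))
    (fun s' => best_of c.+1 s' /\ agree (among [:: 18]) (among [:: 11; 12]) s s').
Proof.
move=> lt_c Et Eoff Ecost best.
apply: (@runs_frame _ no_calls); first exact: no_callsP; first by [].
apply: runs_straight => //; step.
rewrite Et Eoff Ecost -/(val c); case: ifP => ok_c; last first.
  case: best => [[E4 none]|[H1 H2 H3 H4]].
    left; split=> // c'; rewrite ltnS leq_eqVlt => /orP[/eqP ->|/none //].
    by rewrite ok_c.
  right; split=> //; first exact: ltnW.
  move=> c'; rewrite ltnS leq_eqVlt => /orP[/eqP ->|/H4 //].
  by rewrite ok_c.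
case: best => [[E4 none]|[H1 H2 H3 H4]].
  rewrite E4 /=; right; split=> //= c'; rewrite ltnS leq_eqVlt.
  by move=> /orP[/eqP -> //|/none /negbTE ->].
rewrite (_ : imem s 18 0 <= 3); last by lia.
case: leP => H; step; right; split=> //=; try lia.
- move=> c'; rewrite ltnS leq_eqVlt => /orP[/eqP -> //|]; exact: H4.
- move=> c'; rewrite ltnS leq_eqVlt => /orP[/eqP -> //|lt_c' ok'].
  by apply: le_trans (ltW H) _; apply: H4.
Qed.

End Consider.

Definition has_strides s :=
  [/\ imem s 15 0 = stride_i, imem s 16 0 = stride_u & imem s 17 0 = stride_v].

Definition has_params s := [/\ imem s 0 0 = n, imem s 0 1 = p & imem s 0 2 = k].

Lemma fill_table_runs P s :
  has_params s -> has_costs A B s ->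
  runs P fill_table s (400 * (n.+1 * stride_i) + 60) (fun s' =>
    has_strides s' /\ table_ok (qmem s' 10) (imem s' 20) (n.+1 * stride_i)).
Proof.
move=> [En Ep Ek] costs.
apply: (@runs_seq _ _ _ _ 50 (400 * (n.+1 * stride_i) + 10)); last lia.
apply: runs_straight => //; step; rewrite Ep Ek !addn1; set s0 := State _ _.
pose Inv e (s' : state) := exists i u v w,
  [/\ [/\ imem s' 10 0 = e, imem s' 11 0 = i, imem s' 12 0 = u, imem s' 13 0 = v
       & imem s' 14 0 = w], in_range u v w, e = code i u v w
    & table_ok (qmem s' 10) (imem s' 20) e].
apply: (@runs_for_frame _ no_calls (among [:: 10; 11; 12; 13; 14; 18; 20])
  (among [:: 10; 11; 12]) Inv (n.+1 * stride_i) 380) => //.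
- by exists 0, 0, 0, 0; split.
- move=> e s1 lt_e fr [i [u [v [w [[Ee Ei Eu Ev Ew] rg Ecode tab]]]]].
  have costsP a : a \in [:: 0; 1; 2; 5] -> a \notin [:: 10; 11; 12].
    by rewrite !inE => /or4P[] /eqP ->.
  have costs1 : has_costs A B s1 by apply: agree_costs fr costsP costs.
  have En1 : imem s1 0 0 = n by rewrite fr.1.
  have Ep1 : imem s1 0 1 = p by rewrite fr.1.
  have Ek1 : imem s1 0 2 = k by rewrite fr.1.
  have strides1 : has_strides s1 by split; rewrite fr.1.
  split.
    rewrite /= Ei En1 -ltnS -(ltn_pmul2r stride_gt0); apply: leq_ltn_trans lt_e.
    by rewrite Ecode codeE -!addnA leq_addr.
  apply: (@runs_seq _ _ _ _ 320 60); last lia.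
  (* Row 0 and the later rows both end with [advance]; the four cases are the possible carries, each
     raising the address by exactly one. *)
  have fin s2 : agree (among [:: 18; 20]) (among [:: 10; 11; 12]) s1 s2 ->
      table_ok (qmem s2 10) (imem s2 20) e.+1 ->
      runs P advance s2 60 (Inv e.+1).
    move=> fr2 tab2; apply: runs_straight => //; step.
    have H10 : imem s2 10 0 = e by rewrite fr2.1.
    have H11 : imem s2 11 0 = i by rewrite fr2.1.
    have H12 : imem s2 12 0 = u by rewrite fr2.1.
    have H13 : imem s2 13 0 = v by rewrite fr2.1.
    have H14 : imem s2 14 0 = w by rewrite fr2.1.
    have G1 : imem s2 0 1 = p by rewrite fr2.1.
    have G2 : imem s2 0 2 = k by rewrite fr2.1.
    rewrite H10 H11 H12 H13 H14 G1 G2 !addn1 /Inv.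
    move/and3P: rg => [lu lv lw].
    case: ifP => Hw; [|case: ifP => Hv; [|case: ifP => Hu]]; step.
    + exists i, u, v, w.+1; split=> //; first by rewrite /in_range lu lv.
      by rewrite Ecode /code; lia.
    + exists i, u, v.+1, 0; split=> //; first by rewrite /in_range lu Hv.
      have Ew' : w = p by lia.
      by rewrite Ecode /code Ew'; lia.
    + exists i, u.+1, 0, 0; split=> //; first by rewrite /in_range Hu.
      have [Ev' Ew'] : v = k /\ w = p by lia.
      by rewrite Ecode /code Ev' Ew'; lia.
    + exists i.+1, 0, 0, 0; split=> //.
      have [Eu' Ev' Ew'] : [/\ u = k, v = k & w = p] by split; lia.
      by rewrite Ecode /code Eu' Ev' Ew'; lia.
  have [D0 cells] := tab.
  apply: (@runs_if _ _ _ _ _ 300) => //; rewrite /= Ei.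
    move=> i_gt0.
    have Ei1 : i.-1.+1 = i by rewrite prednK.
    have subi : i - 1 = i.-1 by rewrite subn1.
    apply: (@runs_seq _ _ _ _ 3 290) => //.
    apply: runs_straight => //; step; set s2 := State _ _.
    have fr2 : agree (among [:: 18]) (among [:: 11; 12]) s1 s2.
      by split=> // a; rewrite !inE => ne_a; rewrite /s2 /= (negbTE ne_a).
    have read s3 : agree (among [:: 18]) (among [:: 11; 12]) s1 s3 ->
      [/\ [/\ imem s3 10 0 = e, imem s3 11 0 = i, imem s3 12 0 = u, imem s3 13 0 = v
       & imem s3 14 0 = w], has_strides s3, has_costs A B s3 & qmem s3 10 = qmem s1 10].
      move=> fr3; split; last by rewrite fr3.2.
      - by split; rewrite fr3.1.
      - by have [? ? ?] := strides1; split; rewrite fr3.1.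
      - by apply: agree_costs fr3 _ costs1 => a; rewrite !inE => /or4P[] /eqP ->.
    have best2 : best_of e i.-1 u v w (qmem s1 10) 0 s2 by left.
    move: s2 fr2 best2 => s2 fr2 best2.
    apply: (@runs_seq _ _ _ _ 50 240) => //.
    have [[R10 R11 R12 R13 R14] [R15 R16 R17] [RA RB] RD] := read s2 fr2.
    apply: runs_weaken (@consider_runs _ e i.-1 u v w (qmem s1 10) _ _ _ _ _ _ _ _ _ best2) _ _ => //.
    - by rewrite /= R11 R12 R13 R14 addn1 -[X in _ < X]Ei1 ltnS.
    - by rewrite /= R10 R15 RD.
    move=> s3 [best3 fr3']; have fr3 := agree_trans fr2 fr3'.
    apply: (@runs_seq _ _ _ _ 60 180) => //.
    have {R10 R11 R12 R13 R14 R15 R16 R17 RA RB RD}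
      [[R10 R11 R12 R13 R14] [R15 R16 R17] [RA RB] RD] := read s3 fr3.
    apply: runs_weaken (@consider_runs _ e i.-1 u v w (qmem s1 10) _ _ _ _ _ _ _ _ _ best3) _ _ => //.
    - by rewrite /= R12.
    - by rewrite /= R10 R15 R16 RD.
    - by rewrite /= R11 RA subi.
    move=> s4 [best4 fr4']; have fr4 := agree_trans fr3 fr4'.
    apply: (@runs_seq _ _ _ _ 70 110) => //.
    have {R10 R11 R12 R13 R14 R15 R16 R17 RA RB RD}
      [[R10 R11 R12 R13 R14] [R15 R16 R17] [RA RB] RD] := read s4 fr4.
    apply: runs_weaken (@consider_runs _ e i.-1 u v w (qmem s1 10) _ _ _ _ _ _ _ _ _ best4) _ _ => //.
    - by rewrite /= R13.
    - by rewrite /= R10 R15 R17 RD.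
    - by rewrite /= R11 RB subi.
    move=> s5 [best5 fr5']; have fr5 := agree_trans fr4 fr5'.
    apply: (@runs_seq _ _ _ _ 80 30) => //.
    have {R10 R11 R12 R13 R14 R15 R16 R17 RA RB RD}
      [[R10 R11 R12 R13 R14] [R15 R16 R17] [RA RB] RD] := read s5 fr5.
    apply: runs_weaken (@consider_runs _ e i.-1 u v w (qmem s1 10) _ _ _ _ _ _ _ _ _ best5) _ _ => //.
    - by rewrite /= R14.
    - by rewrite /= R10 R15 RD.
    - by rewrite /= R11 RA RB subi.
    move=> s6 [best6 fr6']; have fr6 := agree_trans fr5 fr6'.
    have {R10 R11 R12 R13 R14 R15 R16 R17 RA RB RD}
      [[R10 R11 R12 R13 R14] [R15 R16 R17] [RA RB] RD] := read s6 fr6.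
    apply: runs_straight => //; step; rewrite R10.
    apply: fin.
      split=> a /=; rewrite !inE !negb_or; first by case/andP=> ? ne_a; rewrite (negbTE ne_a) /= fr6.1 // inE.
      by case/and3P=> ne_a ? ?; rewrite (negbTE ne_a) /= fr6.2 // !inE negb_or; apply/andP.
    have R20 : imem s6 20 = imem s1 20 by rewrite fr6.1.
    have e_gt0 : 0 < e.
      apply: leq_trans stride_gt0 _; rewrite Ecode codeE -!addnA.
      by apply: leq_trans (leq_addr _ _); rewrite leq_pmull.
    apply: (table_ok_next tab) => /=.
    - by move=> j lt_j; rewrite R20 RD ltn_eqF.
    - by move=> e_0; rewrite e_0 in e_gt0.
    move=> i' u' v' w' rg' le_i' Ecode'.
    have [Ei' Eu' Ev' Ew'] : [/\ i'.+1 = i, u' = u, v' = v & w' = w].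
      by apply: code_inj => //; rewrite Ecode'.
    subst u' v' w'; rewrite /cell_ok Ecode' /= eqxx -Ei' /= in best6 *.
    (* Predecessors have smaller addresses, so writing entry [e] does not disturb them; [e > 0]
       matters because the subtraction is truncated. *)
    have lt_off c : e - choice_offset c < e.
      have off_gt0 : 0 < choice_offset c.
        by have := stride_gt0; case: c => [|[|[|c]]] /=; lia.
      by move: off_gt0 e_gt0; clear; lia.
    case: best6 => [[_ none]|[H1 H2 H3 H4]].
      (* If [u], [v] and [w] all vanish, leaving the item out is admissible; hence some choice
         always exists and the sentinel 4 cannot survive. *)
      have := none 0 isT; have := none 1 isT; have := none 2 isT; have := none 3 isT.
      by rewrite /=; lia.
    split=> //.
    - by rewrite ltn_eqF // RD.
    - by move=> c lt_c ok_c; rewrite ltn_eqF // RD; apply: H4.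
  rewrite -leqNgt leqn0 => /eqP i_0; rewrite i_0 in Ecode.
  apply: runs_straight => //; step; rewrite Ee.
  apply: fin.
    by split=> a //=; rewrite !inE !negb_or => /and3P[ne_a ? ?]; rewrite (negbTE ne_a).
  apply: (table_ok_next tab) => /=.
  - by move=> j lt_j; rewrite ltn_eqF.
  - by move=> ->.
  move=> i' u' v' w' rg' le_i' Ecode'.
  have [] // : [/\ i'.+1 = 0, u' = u, v' = v & w' = w].
  by apply: code_inj => //; rewrite Ecode'.
- move=> s1 fr [i [u [v [w [[Ee Ei Eu Ev Ew] rg Ecode tab]]]]].
  have En1 : imem s1 0 0 = n by rewrite fr.1.
  rewrite /= Ei En1 -ltnNge -ltnS -(ltn_pmul2r stride_gt0) Ecode.
  exact: code_lt.
- by rewrite /=; lia.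
move=> s1 fr [i [u [v [w [[Ee Ei Eu Ev Ew] rg Ecode tab]]]]].
by split=> //; split; rewrite fr.1.
Qed.


Lemma code_pred c i u v w : c < 4 ->
  code i.+1 (u + (c == 1)) (v + (c == 2)) (w + (c == 3)) - choice_offset c =
  code i u v w.
Proof. by rewrite !codeE mulSn; case: c => [|[|[|[|]]]] //= _; lia. Qed.

(** * Lower bound from the table and reconstruction of an optimum *)

Definition only (x y : nat -> bool) i := \sum_(j < i) (x j && ~~ y j).
Definition both (x y : nat -> bool) i := \sum_(j < i) (x j && y j).

Lemma only_both_le x y i : only x y i + only y x i + both x y i <= i.
Proof.
elim: i => [|i IH]; first by rewrite /only /both !big_ord0.
rewrite /only /both !big_ord_recr /= -/(only x y i) -/(only y x i) -/(both x y i).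
by case: (x i) (y i) => [] [] /=; lia.
Qed.

Lemma only_both x y i : only x y i + both x y i = \sum_(j < i) x j.
Proof. by rewrite -big_split; apply: eq_bigr => j _ /=; case: (x j) (y j) => [] []. Qed.

(** Induction on the prefix of items: the way [(x, y)] treats item [i] is one of the four choices
    over which the entry minimises. *)
Lemma table_lower_bound D ch (x y : nat -> bool) i :
  table_ok D ch (n.+1 * stride_i) -> i <= n ->
  in_range (only x y i) (only y x i) (both x y i) ->
  (D (code i (only x y i) (only y x i) (both x y i))
    <= lin_value A B i (fun j => x j) (fun j => y j))%R.
Proof.
move=> [D0 cells]; elim: i => [|i IH] le_i rg.
  have D00 : D 0 = 0%R by apply: D0; rewrite muln_gt0 stride_gt0.
  by rewrite /only /both /lin_value !big_ord0 [code 0 0 0 0]/= D00.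
have lt_code : code i.+1 (only x y i.+1) (only y x i.+1) (both x y i.+1) < n.+1 * stride_i.
  apply: leq_trans (code_lt _ rg) _.
  by rewrite leq_mul2r ltnS le_i orbT.
have [_ _ _ lower] := cells i _ _ _ rg (only_both_le x y i.+1) lt_code.
move: rg lower (only_both_le x y i.+1) IH; rewrite /lin_value.
rewrite /only /both !big_ord_recr /= -/(only x y i) -/(only y x i) -/(both x y i).
set c := if x i then (if y i then 3 else 1) else (if y i then 2 else 0).
have -> : (x i && ~~ y i) = (c == 1) by rewrite /c; case: (x i) (y i) => [] [].
have -> : (y i && ~~ x i) = (c == 2) by rewrite /c; case: (x i) (y i) => [] [].
have -> : (x i && y i) = (c == 3) by rewrite /c; case: (x i) (y i) => [] [].
have lt_c : c < 4 by rewrite /c; case: (x i) (y i) => [] [].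
have -> : (A i * (x i)%:R + B i * (y i)%:R = choice_cost c i)%R.
  by rewrite /c; case: (x i) (y i) => [] []; rewrite /= ?mulr1 ?mulr0 ?addr0 ?add0r.
move=> /and3P[lu lv lw] lower le_sum IH.
apply: le_trans (lower c lt_c _) _.
  have := only_both_le x y i; move: lt_c; clear.
  by move: c => [|[|[|[|c]]]] //=; lia.
rewrite code_pred // lerD2r; apply: IH; first exact: ltnW.
by apply/and3P; split; lia.
Qed.

(* Address of the entry [(n, e, e, p - e)]: the solutions with [p - e] common
   items. *)
Definition overlap_index e :=
  IGet 0 #0 *i i[15] +i e *i i[16] +i e *i i[17] +i (IGet 0 #1 -i e).

(** The entry for [e] involves [e + e + (p - e) = p + e] distinct items, so the test skips those
    without meaning; [e = 0] is a safe start because [p <= n]. *)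
Definition choose_overlap :=
  (11 :=q QGet 10 (overlap_index #0) ;; 21 :=i #0 ;; 12 :=i #1) ;;
  While (ILe i[12] (IGet 0 #2))
    (If (ILe (IGet 0 #1 +i i[12]) (IGet 0 #0))
       (12 :=q QGet 10 (overlap_index i[12]) ;;
        If (QLe q[11] q[12]) Skip (11 :=q q[12] ;; 21 :=i i[12]))
       Skip ;;
     12 :=i i[12] +i #1).

Definition walk_back :=
  (11 :=i IGet 0 #0 ;; 10 :=i overlap_index i[21] ;;
   4 :=q QAdd q[11] (QMul (QSub (QNum 1%R) q[5]) q[3])) ;;
  While (ILe #1 i[11])
    (18 :=i IGet 20 i[10] ;; 11 :=i i[11] -i #1 ;; 10 :=i i[10] -i i[15] ;;
     If (ILe i[18] #1)
       (ISet 2 i[11] #0 ;;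
        If (ILe i[18] #0) (ISet 1 i[11] #0)
          (ISet 1 i[11] #1 ;; 10 :=i i[10] -i i[16]))
       (ISet 2 i[11] #1 ;;
        If (ILe i[18] #2) (ISet 1 i[11] #0 ;; 10 :=i i[10] -i i[17])
          (ISet 1 i[11] #1 ;; 10 :=i i[10] -i #1))).

Lemma choose_overlap_runs P s :
  has_params s -> has_strides s -> p <= n ->
  let D := qmem s 10 in
  runs P choose_overlap s (100 * k + 50) (fun s' =>
    let u := imem s' 21 0 in
    [/\ u <= k, p + u <= n, qmem s' 11 0 = D (code n u u (p - u))
      & forall u', u' <= k -> p + u' <= n ->
          (qmem s' 11 0 <= D (code n u' u' (p - u')))%R]).
Proof.
move=> [En Ep Ek] [E15 E16 E17] le_pn D.
apply: (@runs_seq _ _ _ _ 30 (100 * k + 20)); last lia.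
apply: runs_straight => //; step; rewrite En Ep E15 E16 E17; set s0 := State _ _.
pose Inv j (s' : state) := let u := imem s' 21 0 in
  [/\ imem s' 12 0 = j.+1, u <= k, p + u <= n,
      qmem s' 11 0 = D (code n u u (p - u))
    & forall u', u' <= j -> p + u' <= n ->
        (qmem s' 11 0 <= D (code n u' u' (p - u')))%R].
apply: (@runs_for_frame _ no_calls (among [:: 12; 21]) (among [:: 11; 12]) Inv k 90) => //.
- have Ecode : code n 0 0 (p - 0) = n * stride_i + (p - 0) by rewrite codeE !addn0.
  split=> //=; rewrite ?addn0 ?Ecode // => u'.
  by rewrite leqn0 => /eqP -> _; rewrite Ecode.
- move=> j s1 lt_j fr [Ej lu ln Eb lower].
  split; first by rewrite /= Ej fr.1 // /s0 /= Ek.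
  apply: runs_straight => //; rewrite /Inv; step.
  have F0 : imem s1 0 = imem s 0 by rewrite fr.1.
  have F15 : imem s1 15 0 = stride_i by rewrite fr.1.
  have F16 : imem s1 16 0 = stride_u by rewrite fr.1.
  have F17 : imem s1 17 0 = stride_v by rewrite fr.1.
  have F10 : qmem s1 10 = D by rewrite fr.2.
  rewrite F0 F10 En Ep F15 F16 F17 Ej addn1 -codeE.
  have new b : (b <= qmem s1 11 0)%R ->
     (p + j.+1 <= n -> (b <= D (code n j.+1 j.+1 (p - j.+1)))%R) ->
     forall u', u' <= j.+1 -> p + u' <= n -> (b <= D (code n u' u' (p - u')))%R.
    move=> le_b Hj u'; rewrite leq_eqVlt ltnS => /orP[/eqP ->|le_u] le_n; first exact: Hj.
    by apply: le_trans le_b _; apply: lower.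
  case: ifP => Hn; [case: leP => Hb|]; step; rewrite ?Ej; split=> //; apply: new => //; first exact: ltW.
  by rewrite Hn.
- move=> s1 fr [Ej _ _ _ _]; rewrite /= Ej fr.1 // /s0 /= Ek.
  by rewrite ltnn.
- by rewrite /=; lia.
by move=> s1 _ [_].
Qed.

(** Along the walk, the current entry plus the cost of the items already decided stays equal to the
    optimum, and likewise for the three counts. *)
Lemma walk_back_runs P s :
  has_params s -> has_strides s ->
  table_ok (qmem s 10) (imem s 20) (n.+1 * stride_i) -> k <= p ->
  let D := qmem s 10 in let u := imem s 21 0 in
  u <= k -> p + u <= n -> qmem s 11 0 = D (code n u u (p - u)) ->
  runs P walk_back s (80 * n + 70) (fun s' =>
    [/\ forall j, j < n -> imem s' 1 j <= 1 /\ imem s' 2 j <= 1,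
        \sum_(j < n) imem s' 1 j = p, \sum_(j < n) imem s' 2 j = p,
        \sum_(j < n) imem s' 1 j * imem s' 2 j = p - u
      & (lin_value A B n (imem s' 1) (imem s' 2) = qmem s 11 0)%R /\
        (qmem s' 4 0 = qmem s 11 0 + (1 - qmem s 5 0) * qmem s 3 0)%R]).
Proof.
move=> [En Ep Ek] [E15 E16 E17] [D0 cells] le_kp D u0 lu0 ln0 Ebest.
apply: (@runs_seq _ _ _ _ 60 (80 * n + 10)); last lia.
apply: runs_straight => //; step; rewrite En Ep E15 E16 E17 -/u0 -codeE.
set s0 := State _ _.
pose Inv t (s' : state) := exists i u v w,
  [/\ [/\ t + i = n, imem s' 11 0 = i & imem s' 10 0 = code i u v w],
      in_range u v w /\ u + v + w <= i,
      forall j, i <= j < n -> imem s' 1 j <= 1 /\ imem s' 2 j <= 1,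
      [/\ u + w + \sum_(i <= j < n) imem s' 1 j = p,
          v + w + \sum_(i <= j < n) imem s' 2 j = p
        & w + \sum_(i <= j < n) imem s' 1 j * imem s' 2 j = p - u0]
    & (D (code i u v w) + \sum_(i <= j < n)
        (A j * (imem s' 1 j)%:R + B j * (imem s' 2 j)%:R) = qmem s 11 0)%R].
apply: (@runs_for_frame _ no_calls (among [:: 1; 2; 10; 11; 18]) xpred0 Inv n 70) => //.
- exists n, u0, u0, (p - u0); rewrite !big_geq //= addr0; split=> //.
  + by rewrite /in_range lu0 leq_subr; split=> //; lia.
  + by move=> j; lia.
  + by rewrite !addn0; split; lia.
- move=> t s1 lt_t fr [i [u [v [w [[Et Ei Ee] [rg le_i] bits [Sx Sy Sxy] Sval]]]]].
  case: i Et Ei Ee le_i bits Sx Sy Sxy Sval => [|i] Et Ei Ee le_i bits Sx Sy Sxy Sval.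
    by move: Et; rewrite addn0 => Et; rewrite Et ltnn in lt_t.
  split; first by rewrite /= Ei.
  have lt_i : i < n by lia.
  have lt_code : code i.+1 u v w < n.+1 * stride_i.
    apply: leq_trans (code_lt _ rg) _.
    by rewrite leq_mul2r; apply/orP; right; lia.
  have [lt_c ok_c Ec _] := cells i u v w rg le_i lt_code.
  have F20 : imem s1 20 = imem s 20 by rewrite fr.1.
  have F15 : imem s1 15 0 = stride_i by rewrite fr.1.
  have F16 : imem s1 16 0 = stride_u by rewrite fr.1.
  have F17 : imem s1 17 0 = stride_v by rewrite fr.1.
  apply: runs_straight => //; step.
  rewrite Ei Ee F20 F15 F16 F17 subn1 /=.
  set c := imem s 20 (code i.+1 u v w) in lt_c ok_c Ec *.
  rewrite -/D in Ec.
  have out s2 (bx by_ u' v' w' : nat) :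
      imem s2 11 0 = i -> imem s2 10 0 = code i u' v' w' ->
      imem s2 1 = (fun j => if j == i then bx else imem s1 1 j) ->
      imem s2 2 = (fun j => if j == i then by_ else imem s1 2 j) ->
      bx <= 1 -> by_ <= 1 ->
      u = u' + (c == 1) -> v = v' + (c == 2) -> w = w' + (c == 3) ->
      bx = (c == 1) + (c == 3) -> by_ = (c == 2) + (c == 3) ->
      choice_cost c i = (A i * bx%:R + B i * by_%:R)%R ->
      Inv t.+1 s2.
    move=> H11 H10 Hx Hy lbx lby Hu Hv Hw Ebx Eby Hcost.
    have old j : i.+1 <= j < n -> imem s2 1 j = imem s1 1 j /\ imem s2 2 j = imem s1 2 j.
      by move=> /andP[lt_j _]; rewrite Hx Hy gtn_eqF.
    have Hxi : imem s2 1 i = bx by rewrite Hx eqxx.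
    have Hyi : imem s2 2 i = by_ by rewrite Hy eqxx.
    have Hxy : bx * by_ = (c == 3).
      by rewrite Ebx Eby; move: lt_c; case: (c) => [|[|[|[|]]]].
    exists i, u', v', w'; split.
    + by split=> //; lia.
    + split; last first.
        by move: ok_c lt_c Hu Hv Hw; clear -le_i; case: (c) => [|[|[|[|]]]] //=; lia.
      by move/and3P: rg => [lu lv lw]; apply/and3P; split; lia.
    + move=> j /andP[le_j lt_j]; have [->|ne_j] := eqVneq j i; first by rewrite Hxi Hyi.
      have rj : i.+1 <= j < n by lia.
      by have [-> ->] := old j rj; apply: bits.
    + rewrite !(big_ltn lt_i) Hxi Hyi Hxy.
      rewrite (eq_big_nat _ _ (fun j rj => (old j rj).1)).
      rewrite (eq_big_nat _ _ (fun j rj => (old j rj).2)).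
      rewrite (@eq_big_nat _ _ _ i.+1 n (fun j => imem s2 1 j * imem s2 2 j) (fun j => imem s1 1 j * imem s1 2 j)); last first.
        by move=> j rj; have [-> ->] := old j rj.
      by split; [rewrite -Sx | rewrite -Sy | rewrite -Sxy]; lia.
    + rewrite (big_ltn lt_i) Hxi Hyi -Hcost -Sval Ec Hu Hv Hw code_pred // addrA.
      congr (_ + _)%R; apply: eq_big_nat => j rj.
      by have [-> ->] := old j rj.
  (* Validity of the recorded choice makes these truncated subtractions exact. *)
  have pred : [/\ u = u - (c == 1) + (c == 1), v = v - (c == 2) + (c == 2),
      w = w - (c == 3) + (c == 3)
    & code i.+1 u v w - choice_offset c
      = code i (u - (c == 1)) (v - (c == 2)) (w - (c == 3))].
    have [Hu Hv Hw] : [/\ u = u - (c == 1) + (c == 1), v = v - (c == 2) + (c == 2)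
      & w = w - (c == 3) + (c == 3)].
      by move: ok_c; clear; case: (c) => [|[|[|[|c']]]] /=; split; lia.
    by split=> //; rewrite -(@code_pred c i (u - (c == 1))) // -Hu -Hv -Hw.
  have {pred} [Hu Hv Hw Hcode] := pred.
  move: lt_c out Hu Hv Hw Hcode; clear; move: (c) => [|[|[|[|c']]]] //= _ out Hu Hv Hw Hcode.
  + apply: (out _ 0 0) Hu Hv Hw _ _ _ => //=; rewrite ?mulr0 ?addr0 //.
  + apply: (out _ 1 0) Hu Hv Hw _ _ _ => //=; rewrite ?mulr0 ?mulr1 ?addr0 ?subnDA //.
    by rewrite -subnDA.
  + apply: (out _ 0 1) Hu Hv Hw _ _ _ => //=; rewrite ?mulr0 ?mulr1 ?add0r //.
    by rewrite -subnDA.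
  + apply: (out _ 1 1) Hu Hv Hw _ _ _ => //=; rewrite ?mulr1 //.
    by rewrite -subnDA.
- move=> s1 fr [i [u [v [w [[Et Ei _] _ _ _ _]]]]].
  by rewrite /= Ei; have -> : i = 0 by lia.
- by rewrite /=; lia.
move=> s1 fr [i [u [v [w [[Et Ei Ee] [rg le_i] bits [Sx Sy Sxy] Sval]]]]].
have i_0 : i = 0 by lia.
(* From [u + v + w <= i] and [i = 0], the walk ends at the origin, where the table holds 0. *)
have [Eu Ev Ew] : [/\ u = 0, v = 0 & w = 0] by split; lia.
rewrite i_0 in bits Sx Sy Sxy Sval; move: bits Sx Sy Sxy Sval; rewrite Eu Ev Ew !big_mkord !add0n => bits Sx Sy Sxy Sval.
have D00 : D 0 = 0%R by apply: D0; rewrite muln_gt0 stride_gt0.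
split=> //; split.
  by rewrite -Sval [code 0 0 0 0]/= D00 add0r.
by rewrite fr.2 //.
Qed.
End Table.

(** * From linear to robust costs *)

Section Cost.
Variables (n : nat) (I : instance n).
Implicit Types (x y : {ffun 'I_n -> bool}) (f : rat).

Definition lin_cost f x y : rat :=
  (\sum_(i < n) (fixed_cost I i * (x i)%:R
                 + (nominal_cost I i + f * deviation I i) * (y i)%:R)
   + (1 - f) * budget I)%R.

Definition robust_value x y : rat := Num.min (lin_cost 0%R x y) (lin_cost 1%R x y).

(* The adversary attains the minimum of the budget and the total deviation of [y]
   by scaling all deviations on [y] by the same factor [t]. *)
Lemma robust_cost_value (R : realType) x y :
  valid I -> robust_cost I x y (ratr (robust_value x y) : R).
Proof.
move=> [C_ge0 c_ge0 d_ge0 G_gt0].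
pose dev := (\sum_(i < n) deviation I i * (y i)%:R)%R : rat.
have dev_ge0 : (0 <= dev)%R by apply: sumr_ge0 => i _; rewrite mulr_ge0 ?ler0n.
have [t /andP[t_ge0 t_le1] Et] :
    exists2 t : rat, (0 <= t <= 1)%R & (t * dev = Num.min (budget I) dev)%R.
  have [le_Gd|lt_dG] := leP (budget I) dev.
    have dev_gt0 := lt_le_trans G_gt0 le_Gd; exists (budget I / dev)%R.
      by rewrite divr_ge0 ?(ltW G_gt0) //= ler_pdivrMr // mul1r.
    by rewrite divfK // gt_eqF.
  by exists 1%R; rewrite ?ler01 ?lexx ?mul1r.
pose nom := (\sum_(i < n) nominal_cost I i * (y i)%:R)%R : rat.
have second (delta : {ffun 'I_n -> R}) : second_stage_cost I y delta =
    (ratr nom + \sum_(i < n) delta i * (y i)%:R)%R.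
  rewrite /second_stage_cost /nom rmorph_sum /= -big_split /=.
  by apply: eq_bigr => i _; rewrite rmorphM /= ratr_nat mulrDl.
exists (ratr (nom + Num.min (budget I) dev)); last first.
  have -> : robust_value x y = (\sum_(i < n) fixed_cost I i * (x i)%:R
      + (nom + Num.min (budget I) dev))%R.
    rewrite /robust_value /lin_cost subrr mul0r addr0 subr0 mul1r.
    under eq_bigr do rewrite mul0r addr0.
    under [X in Num.min _ X]eq_bigr do rewrite mul1r mulrDl addrA.
    by rewrite !big_split /= -/nom -/dev !addr_minr !addrA.
  rewrite rmorphD /=; congr (_ + _)%R; rewrite /first_stage_cost rmorph_sum /=.
  by apply: eq_bigr => i _; rewrite rmorphM /= ratr_nat.
split.
  exists [ffun i => ratr (t * deviation I i * (y i)%:R) : R].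
    split=> [i|].
      rewrite ffunE -[0%R](rmorph0 (ratr : rat -> R)) !ler_rat.
      rewrite !mulr_ge0 ?ler0n //=.
      apply: le_trans (_ : deviation I i * (y i)%:R <= _)%R.
        by rewrite ler_wpM2r ?ler0n // ler_piMl.
      by case: (y i); rewrite ?mulr1 ?mulr0.
    under eq_bigr do rewrite ffunE -mulrA.
    by rewrite -rmorph_sum /= -mulr_sumr Et ler_rat ge_min lexx.
  rewrite second rmorphD /=; congr (_ + _)%R; rewrite -Et mulr_sumr rmorph_sum /=.
  by apply: eq_bigr => i _; rewrite ffunE -mulrA; case: (y i); rewrite ?mulr1 ?mulr0 ?rmorph0.
move=> delta [bnd sum_le]; rewrite second rmorphD /= lerD2l.
have -> : ratr (Num.min (budget I) dev) = Num.min (ratr (budget I) : R) (ratr dev).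
  by case: (leP (budget I) dev) => [le_Gd|/ltW le_dG];
    [rewrite min_l | rewrite min_r]; rewrite ?ler_rat.
rewrite le_min; apply/andP; split.
  apply: le_trans sum_le; apply: ler_sum => i _.
  by have /andP[ge0 _] := bnd i; case: (y i); rewrite ?mulr1 ?mulr0.
rewrite rmorph_sum /=; apply: ler_sum => i _; rewrite rmorphM /= ratr_nat.
by have /andP[_ le_d] := bnd i; rewrite ler_wpM2r ?ler0n.
Qed.

(** Applied to [(x, y)] itself, the two bounds show that its cost for [f] is the smaller of its two
    linear costs, that is, its robust value; applied elsewhere, they bound both terms of every other
    robust value. *)
Lemma optimal_of_linear (R : realType) F x y (f : rat) :
  valid I -> f = 0%R \/ f = 1%R -> F x y ->
  (forall x' y', F x' y' -> lin_cost f x y <= lin_cost 0%R x' y')%R ->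
  (forall x' y', F x' y' -> lin_cost f x y <= lin_cost 1%R x' y')%R ->
  optimal I F x y (ratr (lin_cost f x y) : R).
Proof.
move=> vI Ef Fxy le0 le1.
have -> : lin_cost f x y = robust_value x y.
  apply/le_anti; rewrite le_min le0 //= le1 //= ge_min.
  by case: Ef => ->; rewrite lexx ?orbT.
split=> // [|x' y' Fxy']; first exact: robust_cost_value.
exists (ratr (robust_value x' y')); first exact: robust_cost_value.
rewrite ler_rat [X in (_ <= X)%R]/robust_value le_min.
apply/andP; split.
  apply: le_trans (le0 _ _ Fxy').
  by rewrite ge_min; case: Ef => ->; rewrite lexx ?orbT.
apply: le_trans (le1 _ _ Fxy').
by rewrite ge_min; case: Ef => ->; rewrite lexx ?orbT.
Qed.

(** Unlike [input], this leaves the working memory arbitrary, because later runs of a solver start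
    with the leftovers of earlier ones. *)
Definition input_in ps s :=
  (forall j, imem s 0 j = nth 0 ps j) /\
  (forall a j, a < 4 -> qmem s a j = qmem (input I ps) a j).

Definition solver_post (F : {ffun 'I_n -> bool} -> {ffun 'I_n -> bool} -> Prop)
    f s :=
  exists x y, [/\ outputs s x y (lin_cost f x y), F x y
    & forall x' y', F x' y' -> (lin_cost f x y <= lin_cost f x' y')%R].

End Cost.

(* The third run restores the output of the first when that one is better. *)
Definition main :=
  5 :=q QNum 0%R ;; Call 1 ;;
  (6 :=q q[4] ;; 5 :=q QNum 1%R) ;; Call 1 ;;
  If (QLe q[6] q[4]) (5 :=q QNum 0%R ;; Call 1) Skip.

Section Main.
Variable P : program.
Hypothesis P0 : nth Skip P 0 = main.
Hypothesis Pw : forall j, j \in [:: 1; 2; 3] ->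
  writes_in (among [:: 1; 2; 3]) (fun a => a != 0)
    (fun a => a \notin [:: 0; 1; 2; 3; 5; 6]) (nth Skip P j).

(** The hypothesis [Pw] protects the input, the multiplier in rational cell 5 and the saved optimum
    in cell 6, so each of the at most three calls finds its input intact. *)
Lemma main_solves (R : realType) n (I : instance n) ps F T :
  valid I ->
  (forall s, input_in I ps s ->
     runs P (nth Skip P 1) s T (solver_post I F (qmem s 5 0))) ->
  solves_within R P ps I F (3 * T + 30).
Proof.
move=> vI solver.
have solve s f : input_in I ps s -> qmem s 5 0 = f ->
    runs P (Call 1) s T.+1 (fun s' => [/\ solver_post I F f s', input_in I ps s'
      & qmem s' 6 0 = qmem s 6 0]).
  move=> in_s Ef; apply: (@runs_call _ _ _ T) => //.
  have r := runs_frame Pw (Pw (isT : 1 \in [:: 1; 2; 3])) (solver s in_s).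
  apply: runs_weaken r (leqnn _) _ => s' [post [fi fq]].
  rewrite Ef in post; split=> //; last by rewrite fq.
  case: in_s => in_i in_q; split=> [j|a j lt_a]; first by rewrite fi.
  by rewrite fq ?in_q //; move: lt_a; case: a => [|[|[|[|]]]].
suff [t [s [ex le_t [x [y [v [out opt]]]]]]] :
    runs P (Call 0) (input I ps) (3 * T + 30) (fun s =>
      exists x y v, outputs s x y v /\ optimal I F x y (ratr v : R)).
  by exists t, s, x, y, v.
apply: (@runs_call _ _ _ (3 * T + 29)); last lia.
rewrite P0.
apply: (@runs_seq _ _ _ _ 4 (3 * T + 25)); last lia.
apply: runs_straight => //; step; set s0 := State _ _.
have in0 : input_in I ps s0.
  by split=> [//|a j]; rewrite /s0 /=; case: a => [|[|[|[|]]]].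
apply: (@runs_seq _ _ _ _ T.+1 (2 * T + 24)); last lia.
apply: runs_weaken (solve s0 0%R in0 erefl) (leqnn _) _ => s1 [post1 in1 _].
apply: (@runs_seq _ _ _ _ 10 (2 * T + 14)); last lia.
apply: runs_straight => //; step; set s2 := State _ _.
have in2 : input_in I ps s2.
  case: in1 => in_i in_q; split=> [j|a j lt_a]; first exact: in_i.
  by rewrite -(in_q a j lt_a) /s2 /=; move: lt_a; case: a => [|[|[|[|]]]].
apply: (@runs_seq _ _ _ _ T.+1 (T + 13)); last lia.
apply: runs_weaken (solve s2 1%R in2 erefl) (leqnn _) _ => s3 [post3 in3 E6].
have [x1 [y1 [[_ _ V1] F1 opt1]]] := post1.
have [x3 [y3 [[X3 Y3 V3] F3 opt3]]] := post3.
rewrite /s2 /= in E6.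
apply: (@runs_if _ _ _ _ _ (T + 8)); last by rewrite /=; lia.
  rewrite /= E6 V1 V3 => le_V.
  apply: (@runs_seq _ _ _ _ 4 (T + 4)); last lia.
  apply: runs_straight => //; step; set s4 := State _ _.
  have in4 : input_in I ps s4.
    case: in3 => in_i in_q; split=> [j|a j lt_a]; first exact: in_i.
    by rewrite -(in_q a j lt_a) /s4 /=; move: lt_a; case: a => [|[|[|[|]]]].
  apply: runs_weaken (solve s4 0%R in4 erefl) _ _; first lia.
  move=> s5 [[x5 [y5 [out5 F5 opt5]]] _ _].
  exists x5, y5, (lin_cost I 0%R x5 y5); split=> //.
  apply: optimal_of_linear => //; first by left.
  (* The rerun need not return the same solution as the first run; being optimal for [f = 0], it is
     no worse. *)
  move=> x' y' F'; apply: le_trans (opt5 _ _ F1) _.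
  by apply: le_trans le_V _; apply: opt3.
rewrite /= E6 V1 V3 -ltNge => lt_V; apply: runs_straight => //=; first lia.
exists x3, y3, (lin_cost I 1%R x3 y3); split=> //.
apply: optimal_of_linear => //; first by right.
by move=> x' y' F'; apply: le_trans (ltW lt_V) _; apply: opt1.
Qed.
End Main.

Definition solver_pk := fill_table ;; choose_overlap ;; walk_back.

Lemma solver_pk_runs P A B n p k s :
  has_params n p k s -> has_costs A B s -> p <= n -> 0 < k <= p ->
  runs P solver_pk s (100 * 70 * (n * k ^ 2 * p)) (fun s' =>
    [/\ forall j, j < n -> imem s' 1 j <= 1 /\ imem s' 2 j <= 1,
        [/\ \sum_(j < n) imem s' 1 j = p, \sum_(j < n) imem s' 2 j = p
          & p - k <= \sum_(j < n) imem s' 1 j * imem s' 2 j],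
        (qmem s' 4 0 = lin_value A B n (imem s' 1) (imem s' 2)
                       + (1 - qmem s 5 0) * qmem s 3 0)%R
      & forall x y : nat -> bool,
          \sum_(j < n) x j = p -> \sum_(j < n) y j = p ->
          p - k <= \sum_(j < n) (x j && y j) ->
          (lin_value A B n (imem s' 1) (imem s' 2)
             <= lin_value A B n (fun j => x j) (fun j => y j))%R]).
Proof.
move=> params costs le_pn /andP[k_gt0 le_kp].
(* Since [n], [k] and [p] are positive, each of the four factors [n + 1], [k + 1], [k + 1], [p + 1]
   at most doubles, whence 16. *)
have le_size : n.+1 * stride_i p k <= 16 * (n * k ^ 2 * p).
  rewrite /stride_i /stride_u /stride_v -mulnn.
  have -> : 16 * (n * (k * k) * p) = (2 * n) * ((2 * k) * ((2 * k) * (2 * p))) by lia.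
  by rewrite !leq_mul //; lia.
have k2_gt0 : 0 < k ^ 2 by rewrite expn_gt0 k_gt0.
have le_n : n <= n * k ^ 2 * p by rewrite -mulnA leq_pmulr // muln_gt0 k2_gt0; lia.
have le_k : k <= n * k ^ 2 * p by apply: leq_trans le_n; lia.
have M_gt0 : 0 < n * k ^ 2 * p by lia.
move: (n * k ^ 2 * p) le_size le_n le_k M_gt0 => M le_size le_n le_k M_gt0.
apply: (@runs_seq _ _ _ _ (64 * 100 * M + 60) (180 * M + 120)); last lia.
have r1 := runs_frame (c := fill_table) (calls := no_calls)
  (wi := among [:: 10; 11; 12; 13; 14; 15; 16; 17; 18; 20]) (wq := among [:: 10; 11; 12])
  (@no_callsP P _ _) isT (fill_table_runs P params costs).
apply: runs_weaken r1 _ _; first lia.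
move=> s1 [[strides1 tab1] fr1].
have params1 : has_params n p k s1.
  by have [? ? ?] := params; split; rewrite fr1.1.
apply: (@runs_seq _ _ _ _ (100 * M + 50) (80 * M + 70)); last lia.
have r2 := runs_frame (c := choose_overlap) (calls := no_calls)
  (wi := among [:: 12; 21]) (wq := among [:: 11; 12])
  (@no_callsP P _ _) isT (choose_overlap_runs P params1 strides1 le_pn).
apply: runs_weaken r2 _ _; first lia.
move=> s2 [[lu ln Eb lower] fr2].
have params2 : has_params n p k s2.
  by have [? ? ?] := params1; split; rewrite fr2.1.
have strides2 : has_strides p k s2.
  by have [? ? ?] := strides1; split; rewrite fr2.1.
have F10 : qmem s2 10 = qmem s1 10 by rewrite fr2.2.
have tab2 : table_ok A B p k (qmem s2 10) (imem s2 20) (n.+1 * stride_i p k).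
  by rewrite F10 fr2.1.
rewrite -F10 in Eb.
apply: runs_weaken (walk_back_runs P params2 strides2 tab2 le_kp lu ln Eb) _ _; first lia.
move=> s3 [bits Sx Sy Sxy [Eval Eout]].
have Ef : qmem s2 5 0 = qmem s 5 0 by rewrite fr2.2 // fr1.2.
have Eg : qmem s2 3 0 = qmem s 3 0 by rewrite fr2.2 // fr1.2.
split=> //; first by split=> //; rewrite Sxy; lia.
  by rewrite Eout Eval Ef Eg.
move=> x y sum_x sum_y le_xy; rewrite Eval.
have Ux : only x y n + both x y n = p by rewrite (only_both x y n).
have Uy : only y x n + both x y n = p.
  by rewrite -sum_y -(only_both y x n); congr (_ + _); apply: eq_bigr => j _; rewrite andbC.
have le_both : p - k <= both x y n by [].
have le_u : only x y n <= k by lia.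
have le_un : p + only x y n <= n by have := only_both_le x y n; lia.
apply: le_trans (lower _ le_u le_un) _.
have E1 : only y x n = only x y n by lia.
have E2 : both x y n = p - only x y n by lia.
have rg : in_range p k (only x y n) (only y x n) (both x y n).
  by apply/and3P; split; lia.
by have := table_lower_bound tab1 (leqnn n) rg; rewrite E1 E2.
Qed.

(** * Binary vectors as memory contents *)

Section Encoding.
Variable n : nat.

Definition bits (x : {ffun 'I_n -> bool}) (j : nat) : bool :=
  oapp x false (insub j : option 'I_n).

Lemma bitsE x (i : 'I_n) : bits x i = x i.
Proof. by rewrite /bits valK. Qed.

Definition unbits (g : nat -> nat) : {ffun 'I_n -> bool} := [ffun i : 'I_n => g i == 1].

Lemma unbitsE (g : nat -> nat) (i : 'I_n) : g i <= 1 -> g i = unbits g i.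
Proof. by rewrite ffunE; case: (g i) => [|[|]]. Qed.

Definition item_costs (I : instance n) f j : rat :=
  (cells (nominal_cost I) j + f * cells (deviation I) j)%R.

Lemma cellsE (v : {ffun 'I_n -> rat}) (i : 'I_n) : cells v i = v i.
Proof. by rewrite /cells valK. Qed.

Lemma lin_costE (I : instance n) f (x y : {ffun 'I_n -> bool}) (g h : nat -> nat) :
  (forall i : 'I_n, g i = x i) -> (forall i : 'I_n, h i = y i) ->
  lin_cost I f x y =
  (lin_value (cells (fixed_cost I)) (item_costs I f) n g h + (1 - f) * budget I)%R.
Proof.
move=> Eg Eh; congr (_ + _)%R; apply: eq_bigr => i _.
by rewrite Eg Eh /item_costs !cellsE.
Qed.

Lemma input_costs (I : instance n) ps s : input_in I ps s ->
  has_costs (cells (fixed_cost I)) (item_costs I (qmem s 5 0)) s.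
Proof. by case=> _ in_q; split=> j; rewrite ?(in_q 0) ?(in_q 1) ?(in_q 2). Qed.

Lemma solver_p_post (I : instance n) P p s :
  nth Skip P 2 = select -> nth Skip P 3 = small_select ->
  0 < p <= n -> input_in I [:: n; p] s ->
  runs P solver_p s (830 * 20 * n) (solver_post I (@feasible_p n p) (qmem s 5 0)).
Proof.
move=> P2 P3 p_n in_s; have [in_i in_q] := in_s.
have En : imem s 0 0 = n by rewrite in_i.
have Ep : imem s 0 1 = p by rewrite in_i.
have := solver_p_runs P2 P3 En Ep (input_costs in_s) p_n.
move=> r; apply: runs_weaken r (leqnn _) _ => s' [le1 sum_p val opt].
have Ex (i : 'I_n) : imem s' 1 i = unbits (imem s' 1) i.
  by apply: unbitsE; apply: leq_trans (le1 i (ltn_ord i)); exact: leq_addr.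
have Ey (i : 'I_n) : imem s' 2 i = unbits (imem s' 2) i.
  by apply: unbitsE; apply: leq_trans (le1 i (ltn_ord i)); exact: leq_addl.
exists (unbits (imem s' 1)), (unbits (imem s' 2)).
rewrite (lin_costE _ _ Ex Ey); split.
- by split=> //; rewrite val (in_q 3).
- split; first by rewrite -sum_p; apply: eq_bigr => i _; rewrite -Ex -Ey.
  apply/eqP; rewrite sum_nat_eq0; apply/forallP => i; apply/implyP => _.
  rewrite -Ex -Ey; have := le1 i (ltn_ord i).
  by case: (imem s' 1 i) (imem s' 2 i) => [|[|?]] [|[|?]].
- move=> x y [sum_xy disj].
  rewrite (@lin_costE I _ x y (fun j => bits x j) (fun j => bits y j)); first last.
  + by move=> i; rewrite bitsE.
  + by move=> i; rewrite bitsE.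
  rewrite lerD2r; apply: opt.
  + move=> j lt_j; pose i := Ordinal lt_j; rewrite -[j]/(nat_of_ord i) !bitsE.
    move/eqP: disj; rewrite sum_nat_eq0 => /forallP/(_ i).
    by case: (x i) (y i) => [] [].
  + by rewrite -sum_xy; apply: eq_bigr => i _; rewrite !bitsE.
Qed.

Lemma solver_pk_post (I : instance n) P p k s :
  0 < p <= n -> 0 < k <= p -> input_in I [:: n; p; k] s ->
  runs P solver_pk s (100 * 70 * (n * k ^ 2 * p))
    (solver_post I (@feasible_pk n p k) (qmem s 5 0)).
Proof.
move=> /andP[_ le_pn] k_p in_s; have [in_i in_q] := in_s.
have params : has_params n p k s by split; rewrite in_i.
have := solver_pk_runs P params (input_costs in_s) le_pn k_p.
move=> r; apply: runs_weaken r (leqnn _) _ => s' [le1 [sum_x sum_y sum_xy] val opt].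
have Ex (i : 'I_n) : imem s' 1 i = unbits (imem s' 1) i.
  by apply: unbitsE; have [] := le1 i (ltn_ord i).
have Ey (i : 'I_n) : imem s' 2 i = unbits (imem s' 2) i.
  by apply: unbitsE; have [] := le1 i (ltn_ord i).
exists (unbits (imem s' 1)), (unbits (imem s' 2)).
rewrite (lin_costE _ _ Ex Ey); split.
- by split=> //; rewrite val (in_q 3).
- split.
  + by rewrite -sum_x; apply: eq_bigr => i _; rewrite -Ex.
  + by rewrite -sum_y; apply: eq_bigr => i _; rewrite -Ey.
  + by apply: leq_trans sum_xy _; apply: leq_sum => i _; rewrite -Ex -Ey.
- move=> x y [Sx Sy Sxy].
  rewrite (@lin_costE I _ x y (fun j => bits x j) (fun j => bits y j)); first last.
  + by move=> i; rewrite bitsE.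
  + by move=> i; rewrite bitsE.
  rewrite lerD2r; apply: opt.
  + by rewrite -[RHS]Sx; apply: eq_bigr => i _; rewrite bitsE.
  + by rewrite -[RHS]Sy; apply: eq_bigr => i _; rewrite bitsE.
  + apply: leq_trans Sxy _; apply: leq_sum => i _; rewrite !bitsE.
    by case: (x i) (y i) => [] [].
Qed.

End Encoding.

Theorem corollary2 (R : realType) :
  (exists (P : program) (K : nat),
     forall (n p : nat) (I : instance n),
       valid I -> 0 < p <= n ->
       solves_within R P [:: n; p] I (@feasible_p n p) (K * n))
  /\
  (exists (P : program) (K : nat),
     forall (n p k : nat) (I : instance n),
       valid I -> 0 < p <= n -> 0 < k <= p ->
       solves_within R P [:: n; p; k] I (@feasible_pk n p k)
         (K * (n * k ^ 2 * p))).
Proof.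
have weaken n (I : instance n) ps F P T T' :
    solves_within R P ps I F T -> T <= T' -> solves_within R P ps I F T'.
  move=> [t [s [x [y [v [ex le_t out opt]]]]]] le_T.
  by exists t, s, x, y, v; split=> //; apply: leq_trans le_T.
split.
  exists [:: main; solver_p; select; small_select], (3 * 830 * 20 + 30).
  move=> n p I vI p_n.
  apply: (weaken _ _ _ _ _ (3 * (830 * 20 * n) + 30)).
    apply: main_solves => //.
      by move=> j; rewrite !inE => /or3P[] /eqP ->.
    by move=> s in_s; apply: solver_p_post.
  by lia.
(* Procedures 2 and 3 are absent here; looking them up yields [Skip], which writes nothing. *)
exists [:: main; solver_pk], (3 * 100 * 70 + 30).
move=> n p k I vI p_n k_p.
apply: (weaken _ _ _ _ _ (3 * (100 * 70 * (n * k ^ 2 * p)) + 30)).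
  apply: main_solves => //.
    by move=> j; rewrite !inE => /or3P[] /eqP ->.
  by move=> s in_s; apply: solver_pk_post.
have M_gt0 : 0 < n * k ^ 2 * p by rewrite !muln_gt0; lia.
by move: (n * k ^ 2 * p) M_gt0 => M; lia.
Qed.
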